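(* Let $X$ and $Y$ be dust-like self-similar sets generated by the iterated function systems $\Phi$ and $\Psi$ respectively, and assume that $\dim_{\mathrm H} X=\dim_{\mathrm H} Y=s>0$. Furthermore, assume that at least one of the sets of ratios $R(\Phi)$, $R(\Psi)$ is commensurable. Then the following are equivalent: (1) There exists a Lipschitz surjection $X\to Y$. (2) The set $R(\Phi)\cup R(\Psi)$ is commensurable.
   Context: A self-similar set is a compact set $X\subset\mathbb R^d$ satisfying $X=\bigcup_{i=1}^n S_i(X)$, where each $S_i:\mathbb R^d\to\mathbb R^d$ is a contracting similarity (i.e. $|S_i(x)-S_i(y)|=r_i|x-y|$ with $r_i\in(0,1)$, the ratio of $S_i$). The set $\Phi=\{S_1,\dots,S_n\}$ is the iterated function system (IFS) generating $X$. $X$ is dust-like (with respect to its generating IFS) if the sets $S_i(X)$ are pairwise disjoint. $R(\Phi)$ denotes the set of ratios of the similarities in $\Phi$. A set $R\subseteq\mathbb R^+$ is commensurable if $\log r_1/\log r_2\in\mathbb Q$ for every $r_1,r_2\in R$. $\dim_{\mathrm H}$ is the Hausdorff dimension. *)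

(* Defs.v *)
From HB Require Import structures.
From mathcomp Require Import all_boot all_order all_algebra.
From mathcomp Require Import all_classical all_reals all_analysis.
Import Order.TTheory GRing.Theory Num.Theory.
Import numFieldNormedType.Exports.

Set Implicit Arguments.
Unset Strict Implicit.
Unset Printing Implicit Defensive.

Local Open Scope classical_set_scope.
Local Open Scope ring_scope.

(* The library norm on 'rV[R]_d is the sup norm, so the Euclidean metric is
   introduced separately. The two induce the same topology, so the library's
   [compact] is compactness in Euclidean space. *)
Definition edist (R : realType) (d : nat) (x y : 'rV[R]_d) : R :=
  Num.sqrt (\sum_(i < d) (x 0 i - y 0 i) ^+ 2).

Definition contracting_similarity (R : realType) (d : nat)
    (r : R) (f : 'rV[R]_d -> 'rV[R]_d) : Prop :=
  0 < r < 1 /\ forall x y, edist (f x) (f y) = r * edist x y.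

Definition is_ifs (R : realType) (d n : nat)
    (Phi : 'I_n -> 'rV[R]_d -> 'rV[R]_d) : Prop :=
  forall i, exists r, contracting_similarity r (Phi i).

(* For 0 < d a similarity has exactly one ratio; in dimension 0 every r in
   ]0, 1[ qualifies, but there every set has Hausdorff dimension 0. *)
Definition ratios (R : realType) (d n : nat)
    (Phi : 'I_n -> 'rV[R]_d -> 'rV[R]_d) : set R :=
  [set r | exists i, contracting_similarity r (Phi i)].

Definition self_similar (R : realType) (d n : nat)
    (Phi : 'I_n -> 'rV[R]_d -> 'rV[R]_d) (X : set 'rV[R]_d) : Prop :=
  [/\ is_ifs Phi, compact X & X = \bigcup_(i in [set: 'I_n]) (Phi i @` X)].

Definition dust_like (R : realType) (d n : nat)
    (Phi : 'I_n -> 'rV[R]_d -> 'rV[R]_d) (X : set 'rV[R]_d) : Prop :=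
  self_similar Phi X /\
  forall i j, i != j -> (Phi i @` X) `&` (Phi j @` X) = set0.

(* Intended for sets of positive reals not containing 1, such as sets of
   ratios: there [ln r2] is nonzero and the quotient is a genuine one. *)
Definition commensurable (R : realType) (A : set R) : Prop :=
  forall r1 r2, A r1 -> A r2 -> exists q : rat, ln r1 / ln r2 = ratr q.

(* The supremum is -oo when U is empty. *)
Definition diameter (R : realType) (d : nat) (U : set 'rV[R]_d) : \bar R :=
  ereal_sup [set z | exists x y, [/\ U x, U y & z = (edist x y)%:E]].

(* diam(U)^t, where the empty set counts for 0 and a point for 0^0 = 1 when
   t = 0. *)
Definition diam_pow (R : realType) (d : nat) (t : R) (U : set 'rV[R]_d) :
    \bar R :=
  if U == set0 then 0%E else poweR (diameter U) t.

Definition hausdorff_premeasure (R : realType) (d : nat) (t delta : R)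
    (A : set 'rV[R]_d) : \bar R :=
  ereal_inf [set (\sum_(k <oo) diam_pow t (U k))%E | U in
    [set U : (set 'rV[R]_d)^nat |
      A `<=` \bigcup_k U k /\ forall k, (diameter (U k) <= delta%:E)%E]].

Definition hausdorff_measure (R : realType) (d : nat) (t : R)
    (A : set 'rV[R]_d) : \bar R :=
  ereal_sup [set hausdorff_premeasure t delta A |
    delta in [set delta : R | 0 < delta]].

Definition hausdorff_dim (R : realType) (d : nat) (A : set 'rV[R]_d) :
    \bar R :=
  ereal_inf [set t%:E | t in
    [set t : R | 0 <= t /\ hausdorff_measure t A = 0%E]].

Definition lipschitz_on (R : realType) (d e : nat) (X : set 'rV[R]_d)
    (f : 'rV[R]_d -> 'rV[R]_e) : Prop :=
  exists L : R, forall x y, X x -> X y -> edist (f x) (f y) <= L * edist x y.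

(* A map X -> Y is represented by a function on the whole space, of which only
   the values on X matter. *)
Definition lipschitz_surjection (R : realType) (d e : nat)
    (X : set 'rV[R]_d) (Y : set 'rV[R]_e)
    (f : 'rV[R]_d -> 'rV[R]_e) : Prop :=
  lipschitz_on X f /\ f @` X = Y.

(* Main.v *)
Require Import Defs.
From HB Require Import structures.
From mathcomp Require Import all_boot all_order all_algebra.
From mathcomp Require Import all_classical all_reals all_analysis.
From mathcomp Require Import zify ring lra.
Import Order.TTheory GRing.Theory Num.Theory.
Import numFieldNormedType.Exports.

Set Implicit Arguments.
Unset Strict Implicit.
Unset Printing Implicit Defensive.

Local Open Scope classical_set_scope.
Local Open Scope ring_scope.

Local Notation edist := Defs.edist.

(** A dust-like set is bi-Lipschitz to a symbolic space: sequences of symbols,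
    two of them being at a distance equal to the product of the ratios along
    their longest common prefix ([coding_ex]). Counting cylinders gives Moran's
    equation ([moran_equation]): for ratios [r i] and dimension [s], the
    numbers [p i = r i ^ s] add up to 1. After raising distances to the power
    [s], the theorem is about symbolic spaces with weights [p] and [q] of sum 1,
    and [p i] is also the share of the cylinder [i] in the natural measure.

    From commensurability to a surjection ([lipschitz_surjection_ex]). If all
    weights are powers of one number [lam], then [lam] is a common root of the
    polynomials [1 - sum X^(a i)] and [1 - sum X^(b j)]. One needs a finite
    collection of source cylinders, with prescribed levels, which after some
    subdivisions becomes the union of its own copies shifted by the levels
    [b j] of the target cylinders. In terms of generating polynomials this asks
    for [T * (1 - sum X^(b j)) = S * (1 - sum X^(a i))] with nonnegative integer
    coefficients. A solution is obtained from the greatest common divisor [G] of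
    the two polynomials: both cofactors, multiplied by the real polynomial
    [- G / (X - lam)], have strictly positive coefficients, and this polynomial
    can be approximated by a rational one ([degree_exchange]). The bookkeeping
    of the subdivisions is a finite transducer whose output follows its input at
    bounded distance, that is, a Lipschitz map; tracing runs backwards shows that
    it is onto. No part of the source needs to have a prescribed measure, since
    the levels of the initial cylinders are only labels.

    From a surjection to commensurability ([lipschitz_surjection_relations]).
    Consider coverings of the target by finitely many Lipschitz images of the
    source, each weighted by its Lipschitz constant. Restricting a covering to
    the preimage of a target cylinder and rescaling gives another covering, and
    the total weight is the average of the total weights obtained over the
    first-level cylinders. A covering of least total weight exists by
    compactness, so all its rescaled restrictions have the same total weight:
    the minimal covering scales measure exactly. If the source weights are
    powers of one number, comparing the restrictions to the nested cylinders
    [j j ... j] yields by finiteness a relation between [q j] and that number. In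
    the other case, follow a piece of the covering down the cylinders
    [i i ... i] of the source. In a minimal covering no piece is redundant, so
    some target cylinder is covered by that piece alone; compactness makes its
    size uniform, whence the rescaled weight of the piece takes only finitely
    many values, and a coincidence is a relation between [p i] and the target
    weights. *)

(** * Symbolic spaces *)

Definition agree (T : Type) (n : nat) (x y : nat -> T) : Prop :=
  forall k, (k < n)%N -> x k = y k.

Definition scons (T : Type) (a : T) (x : nat -> T) : nat -> T :=
  fun k => if k is k'.+1 then x k' else a.

Definition stail (T : Type) (x : nat -> T) : nat -> T := fun k => x k.+1.

Definition wt (R : realType) (T : Type) (p : T -> R) (x : nat -> T) (n : nat) : R :=
  \prod_(k < n) p (x k).

Section Agree.
Variable T : Type.
Implicit Types x y z : nat -> T.

Lemma agree_refl n x : agree n x x. Proof. by []. Qed.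

Lemma agree_sym n x y : agree n x y -> agree n y x.
Proof. by move=> h k /h. Qed.

Lemma agree_trans n x y z : agree n x y -> agree n y z -> agree n x z.
Proof. by move=> h g k kn; rewrite h// g. Qed.

Lemma agreeW n m x y : (n <= m)%N -> agree m x y -> agree n x y.
Proof. by move=> nm h k kn; apply: h; apply: leq_trans nm. Qed.

Lemma agreeS n x y : agree n x y -> x n = y n -> agree n.+1 x y.
Proof. by move=> h e k; rewrite ltnS leq_eqVlt => /orP[/eqP->//|/h]. Qed.

Lemma agree_scons n a x y : agree n x y -> agree n.+1 (scons a x) (scons a y).
Proof. by move=> h [|k]//= /h. Qed.

Lemma agree_stail n x y : agree n.+1 x y -> agree n (stail x) (stail y).
Proof. by move=> h k kn; apply: h. Qed.

Lemma agree_head n x y : x 0%N = y 0%N -> agree n (stail x) (stail y) ->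
  agree n.+1 x y.
Proof. by move=> e h [|k]//= /h. Qed.

Lemma scons_stail x : scons (x 0%N) (stail x) = x.
Proof. by apply/funext => -[|k]. Qed.

Lemma agree_all x y : (forall n, agree n x y) -> x = y.
Proof. by move=> h; apply/funext => k; apply: (h k.+1). Qed.

Lemma first_difference (x y : nat -> T) :
  x <> y -> exists n, agree n x y /\ x n <> y n.
Proof.
move=> xy; have [k kP] : exists k, `[< x k <> y k >].
  apply: contrapT => h; apply: xy; apply/funext => k; apply: contrapT => e.
  by apply: h; exists k; apply/asboolP.
have [n /asboolP nP nmin] := ex_minnP (ex_intro (fun k => is_true `[< x k <> y k >]) k kP).
exists n; split => // j jn; apply: contrapT => /asboolP /nmin; lia.
Qed.

Lemma first_disagreement n (x y : nat -> T) :
  ~ agree n x y -> exists k, [/\ (k < n)%N, agree k x y & x k <> y k].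
Proof.
move=> h; have /first_difference[k [kP e]] : x <> y by move=> e; apply: h; rewrite e.
exists k; split => //; rewrite ltnNge; apply/negP => nk; apply: h.
exact: agreeW kP.
Qed.

End Agree.

Section Weights.
Variables (R : realType) (m : nat) (p : 'I_m -> R).
Hypothesis p01 : forall i, 0 < p i < 1.
Implicit Types x y : nat -> 'I_m.

Lemma wt0 x : wt p x 0 = 1. Proof. by rewrite /wt big_ord0. Qed.

Lemma wtS x n : wt p x n.+1 = p (x 0%N) * wt p (stail x) n.
Proof. by rewrite /wt big_ord_recl. Qed.

Lemma wtSr x n : wt p x n.+1 = wt p x n * p (x n).
Proof. by rewrite /wt big_ord_recr. Qed.

Lemma wt_agree x y n : agree n x y -> wt p x n = wt p y n.
Proof. by move=> h; apply: eq_bigr => k _; rewrite h. Qed.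

Lemma wt_gt0 x n : 0 < wt p x n.
Proof. by apply: prodr_gt0 => k _; case/andP: (p01 (x k)). Qed.

Lemma wt_decr x n k : (n <= k)%N -> wt p x k <= wt p x n.
Proof.
move/subnK <-; elim: (k - n)%N => //= d IH; rewrite addSn wtSr.
apply: le_trans IH; rewrite ler_piMr ?ltW ?wt_gt0//.
by case/andP: (p01 (x (d + n)%N)).
Qed.

Lemma wt_le1 x n : wt p x n <= 1.
Proof. by rewrite -(wt0 x); apply: wt_decr. Qed.

Lemma ratio_bounds : exists lo hi : R,
  [/\ 0 < lo < 1, 0 < hi < 1 & forall i, lo <= p i <= hi].
Proof.
pose lo := \big[Num.min/2^-1]_(i < m) p i; pose hi := \big[Num.max/2^-1]_(i < m) p i.
have lo_le i : lo <= p i by apply: bigmin_le_cond.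
have hi_ge i : p i <= hi by apply: le_bigmax_cond.
have lo2 : lo <= 2^-1 by apply: bigmin_le_id.
have hi2 : 2^-1 <= hi by apply: bigmax_ge_id.
exists lo, hi; split.
- apply/andP; split; last by lra.
  by apply: lt_bigmin => [|i _]; [lra|case/andP: (p01 i)].
- apply/andP; split; first by lra.
  apply/bigmax_ltP; split; first by lra.
  by move=> i _; case/andP: (p01 i).
- by move=> i; rewrite lo_le hi_ge.
Qed.

Lemma wt_bounds (lo hi : R) x n : 0 < lo -> (forall i, lo <= p i <= hi) ->
  lo ^+ n <= wt p x n <= hi ^+ n.
Proof.
move=> lo0 h; elim: n => [|n /andP[IH1 IH2]]; first by rewrite !expr0 wt0 lexx.
have /andP[h1 h2] := h (x n); have wx := wt_gt0 x n; have hp := lt_le_trans lo0 h1.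
rewrite !exprSr wtSr; apply/andP; split; apply: ler_pM => //.
- by apply: exprn_ge0; apply: ltW.
- exact: ltW.
- exact: ltW.
- exact: ltW.
Qed.

End Weights.

Lemma expr_lt_eps (R : realType) (h e : R) : 0 < h < 1 -> 0 < e ->
  exists n, h ^+ n < e.
Proof.
move=> /andP[h0 h1] e0.
have : `|h| < 1 by rewrite ger0_norm ?ltW.
move=> /cvg_expr /cvgrPdist_lt /(_ e e0).
case=> n _ /(_ n (leqnn n)) /=; rewrite sub0r normrN ger0_norm ?exprn_ge0 ?ltW//.
by exists n.
Qed.

(** * Limits along an ultrafilter *)

(** A free ultrafilter turns every pigeonhole argument into the choice of one
    value, and all these choices are compatible with each other. *)
Lemma free_ultrafilter : exists U : set_system nat,
  UltraFilter U /\ forall n, U [set k | (n <= k)%N].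
Proof.
have [U [UU sU]] := ultraFilterLemma eventually_filter.
by exists U; split => // n; apply: sU; exists n.
Qed.

Section Ultra.
Variable U : set_system nat.
Hypothesis UU : UltraFilter U.

Lemma ultraI (A B : set nat) : U A -> U B -> U (A `&` B).
Proof. exact: filterI. Qed.

Lemma ultraS (A B : set nat) : A `<=` B -> U A -> U B.
Proof. exact: filterS. Qed.

Lemma ultra_ex (A : set nat) : U A -> exists k, A k.
Proof. by move=> /filter_ex. Qed.

Lemma ultraT (A : set nat) : (forall k, A k) -> U A.
Proof. by move=> h; apply: ultraS filterT => k _. Qed.

Lemma ultra_all (I : finType) (P : I -> set nat) :
  (forall i, U (P i)) -> U [set k | forall i, P i k].
Proof. exact: (@filter_forall nat I P U _). Qed.

Lemma ultra_const (T : finType) (g : nat -> T) : exists a, U [set k | g k = a].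
Proof.
apply: contrapT => h.
have : U [set k | forall a : T, g k <> a].
  apply: (@ultra_all T (fun a => [set k | g k <> a])) => a.
  by case: (in_ultra_setVsetC [set k | g k = a] UU) => // ha; case: h; exists a.
by case/ultra_ex => k /(_ (g k)).
Qed.

Lemma ultra_const_nat (g : nat -> nat) B : U [set k | (g k <= B)%N] ->
  exists a, U [set k | g k = a].
Proof.
move=> h; have [a ha] := ultra_const (fun k => inord (g k) : 'I_B.+1).
exists a; apply: ultraS (ultraI h ha) => k /= [gB <-].
by rewrite inordK.
Qed.

Lemma ultra_seq (T : finType) (s : nat -> nat -> T) :
  exists x, forall n, U [set k | agree n (s k) x].
Proof.
have /choice[x xP] : forall n, exists a, U [set k | s k n = a].
  by move=> n; apply: ultra_const.
exists x; elim => [|n IH]; first by apply: ultraT.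
by apply: ultraS (ultraI IH (xP n)) => k [/= h e]; apply: agreeS.
Qed.

(** A cluster point of the image of an ultrafilter is a limit of it. *)
Lemma ultra_compact (T : topologicalType) (A : set T) (g : nat -> T) :
  compact A -> (forall k, A (g k)) ->
  exists2 l, A l & forall B, nbhs l B -> U [set k | B (g k)].
Proof.
move=> cA gA; have [|l [Al cl]] := cA (g @ U) _.
  by apply: ultraT => k; apply: gA.
exists l => // B lB.
case: (in_ultra_setVsetC [set k | B (g k)] UU) => // nB.
by have [x [/= xC xB]] := cl (~` B) B nB lB; case: (xC xB).
Qed.

Lemma ultra_real (R : realType) (g : nat -> R) (a b : R) :
  (forall k, a <= g k <= b) ->
  exists l, a <= l <= b /\
    forall e, 0 < e -> U [set k | `|g k - l| < e].
Proof.
move=> gab; have [|l /=] := @ultra_compact R _ g (@segment_compact R a b).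
  by move=> k; rewrite /= in_itv /=.
rewrite in_itv /= => lab gl; exists l; split => // e e0.
by apply: ultraS (gl _ (nbhsx_ballx l e e0)) => k /=; rewrite -ball_normE /= distrC.
Qed.

End Ultra.

(** * Lipschitz maps between symbolic spaces *)

(** The Lipschitz condition for the distance given by the weight of the longest
    common prefix, stated so that it passes to pointwise limits: a target symbol
    is determined as long as the weight of the target cylinder exceeds the
    allowed bound. *)
Definition Lip (R : realType) (m n : nat) (p : 'I_m -> R) (q : 'I_n -> R)
    (a : R) (f : (nat -> 'I_m) -> nat -> 'I_n) : Prop :=
  forall k l x y, agree k x y -> a * wt p x k < wt q (f x) l ->
    agree l.+1 (f x) (f y).

Definition wcat (T : Type) (u : seq T) (x : nat -> T) : nat -> T :=
  foldr (@scons T) x u.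

Definition wordwt (R : realType) (T : Type) (p : T -> R) (u : seq T) : R :=
  \prod_(i <- u) p i.

Lemma wcat_cat (T : Type) (u v : seq T) x : wcat (u ++ v) x = wcat u (wcat v x).
Proof. by rewrite /wcat foldr_cat. Qed.

Lemma wcat_rcons (T : Type) (u : seq T) i x : wcat (rcons u i) x = wcat u (scons i x).
Proof. by rewrite -cats1 wcat_cat. Qed.

Lemma mkseq_stail (T : Type) (y : nat -> T) n :
  mkseq y n.+1 = y 0%N :: mkseq (stail y) n.
Proof. by rewrite /mkseq /= (iotaDl 1 0 n) -map_comp. Qed.

Lemma wcat_mkseq (T : Type) (y x : nat -> T) n : agree n (wcat (mkseq y n) x) y.
Proof.
elim: n y => [|n IH] y //; rewrite mkseq_stail.
by apply: agree_head => //=; exact: (IH (stail y)).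
Qed.

Section LipMaps.
Variables (R : realType) (m n : nat) (p : 'I_m -> R) (q : 'I_n -> R).
Hypothesis p01 : forall i, 0 < p i < 1.
Hypothesis q01 : forall j, 0 < q j < 1.
Notation Lip := (Lip p q).
Implicit Types (f : (nat -> 'I_m) -> nat -> 'I_n) (a : R).

Lemma wordwt_gt0 (u : seq 'I_m) : 0 < wordwt p u.
Proof. by apply: prodr_gt0 => i _; case/andP: (p01 i). Qed.

Lemma LipW a b f : a <= b -> Lip a f -> Lip b f.
Proof.
move=> ab h k l x y e lt; apply: (h k l) => //; apply: le_lt_trans lt.
by rewrite ler_wpM2r// ltW// wt_gt0.
Qed.

Lemma Lip_scons a f i : Lip a f -> Lip (a * p i) (f \o scons i).
Proof.
move=> h k l x y e lt; apply: (h k.+1 l); first exact: agree_scons.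
by rewrite wtS /= mulrA.
Qed.

Lemma Lip_stail a f j : Lip a f -> (forall x, f x 0%N = j) ->
  Lip (a / q j) (@stail _ \o f).
Proof.
move=> h hj k l x y e lt; apply: agree_stail; apply: (h k) => //.
have /andP[q0 _] := q01 j.
by rewrite wtS hj -ltr_pdivrMl// mulrA [_^-1 * _]mulrC.
Qed.

Lemma Lip_head a f x y : a < 1 -> Lip a f -> f x 0%N = f y 0%N.
Proof. by move=> a1 h; apply: (h 0%N 0%N) => //; rewrite !wt0 mulr1. Qed.

(** The common prefix has to be so long that [A] times its weight falls below
    every target weight of length [l]. *)
Lemma Lip_unif A l : exists K, forall a f x y, a <= A -> Lip a f ->
  agree K x y -> agree l (f x) (f y).
Proof.
have [plo [phi [/andP[plo0 _] phi01 pb]]] := ratio_bounds p01.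
have [qlo [qhi [/andP[qlo0 _] _ qb]]] := ratio_bounds q01.
have A0 : 0 < `|A| + 1 by apply: ltr_wpDl.
have e0 : 0 < qlo ^+ l / (`|A| + 1) by rewrite divr_gt0 ?exprn_gt0.
have [K hK] := expr_lt_eps phi01 e0.
exists K => a f x y aA h xy; apply: (agreeW (leqnSn l)); apply: (h K) => //.
have /andP[_ wK] := wt_bounds p01 x K plo0 pb.
have /andP[wl _] := wt_bounds q01 (f x) l qlo0 qb.
apply: lt_le_trans wl; apply: (@le_lt_trans _ _ ((`|A| + 1) * phi ^+ K)).
  apply: (@le_trans _ _ ((`|A| + 1) * wt p x K)).
    apply: ler_wpM2r; first exact/ltW/wt_gt0.
    by apply: le_trans aA _; apply: le_trans (ler_norm _) _; rewrite lerDl.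
  by rewrite ler_wpM2l// ltW.
by rewrite mulrC -ltr_pdivlMr.
Qed.

End LipMaps.

(** * Coverings of a symbolic space by weighted Lipschitz images *)

Section Coverings.
Variables (R : realType) (m n : nat) (p : 'I_m -> R) (q : 'I_n -> R).
Hypothesis p01 : forall i, 0 < p i < 1.
Hypothesis q01 : forall j, 0 < q j < 1.
Hypothesis sp : \sum_i p i = 1.
Variable i0 : 'I_m.
Variables lo hi qlo : R.
Hypothesis lo0 : 0 < lo.
Hypothesis phi : forall i, lo <= p i <= hi.
Hypothesis qge : forall j, qlo <= q j.
Variable M : nat.
Hypothesis hM : hi ^+ M <= qlo.

(** A map together with its weight, which is at once a Lipschitz constant of the
    map and the mass given to its source. *)
Definition piece := (R * ((nat -> 'I_m) -> nat -> 'I_n))%type.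
Implicit Types (c : seq piece) (x : piece).

Definition mass c : R := \sum_(x <- c) x.1.

Definition covers c : Prop := forall y, exists x z, x \in c /\ x.2 z = y.

(** Weights are kept between [lo / 2] and [1 / 2]: below [1] the first symbol of
    the image is constant, and subdividing a piece of weight more than [1 / 2]
    does not go below [lo / 2]. With bounded total weight the number of pieces
    is then bounded. *)
Definition large_pieces c : Prop := forall x, x \in c ->
  lo / 2 <= x.1 /\ Lip p q x.1 x.2.

Definition good c : Prop :=
  [/\ large_pieces c, forall x, x \in c -> x.1 <= 2^-1 & covers c].

Definition split_piece x : seq piece :=
  if x.1 <= 2^-1 then [:: x]
  else [seq (x.1 * p i, x.2 \o scons i) | i <- enum 'I_m].

Definition refine c : seq piece := flatten [seq split_piece x | x <- c].

Definition head_symbol x : 'I_n := x.2 (fun=> i0) 0%N.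

(** The part of a covering above the target cylinder [j], rescaled. *)
Definition zoom j c : seq piece :=
  [seq (x.1 / q j, @stail _ \o x.2) | x <- c & head_symbol x == j].

(** Rescaling multiplies weights by at most [1 / qlo], which [M] subdivisions
    compensate. *)
Definition zoomr j c : seq piece := iter M refine (zoom j c).

Definition zoomw (w : seq 'I_n) c : seq piece := foldl (fun c j => zoomr j c) c w.

Lemma refineP c y : y \in refine c -> exists x, x \in c /\
  ((y = x /\ x.1 <= 2^-1) \/
   exists i, y = (x.1 * p i, x.2 \o scons i) /\ 2^-1 < x.1).
Proof.
move=> /flatten_mapP[x xc]; rewrite /split_piece; case: leP => h.
  by rewrite inE => /eqP ->; exists x; split => //; left.
by move=> /mapP[i _ ->]; exists x; split => //; right; exists i.
Qed.

Lemma refine_mass c : mass (refine c) = mass c.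
Proof.
rewrite /mass /refine big_flatten big_map /=; apply: eq_bigr => x _.
rewrite /split_piece; case: leP => h; first by rewrite big_seq1.
by rewrite big_map big_enum /= -mulr_sumr sp mulr1.
Qed.

Lemma iter_refine_mass k c : mass (iter k refine c) = mass c.
Proof. by elim: k => //= k IH; rewrite refine_mass. Qed.

Lemma refine_covers c : covers c -> covers (refine c).
Proof.
move=> h y; have [x [z [xc xy]]] := h y.
have [hx|hx] := leP x.1 2^-1.
  by exists x, z; split => //; apply/flatten_mapP; exists x => //;
     rewrite /split_piece hx inE.
exists (x.1 * p (z 0%N), x.2 \o scons (z 0%N)), (stail z); split.
  apply/flatten_mapP; exists x => //; rewrite /split_piece leNgt hx /=.
  by apply/mapP; exists (z 0%N) => //; rewrite mem_enum.
by rewrite /= scons_stail.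
Qed.

Lemma refine_large c : large_pieces c -> large_pieces (refine c).
Proof.
move=> h y /refineP[x [/h [h1 h2] [[-> _]|[i [-> hx]]]]] //=.
have /andP[pl _] := phi i; have /andP[p0 _] := p01 i.
split; last exact: Lip_scons.
rewrite mulrC; apply: ler_pM => //; try exact: ltW; by rewrite ?invr_ge0.
Qed.

Lemma refine_le (B : R) c : (forall x, x \in c -> x.1 <= Num.max 2^-1 B) ->
  forall x, x \in refine c -> x.1 <= Num.max 2^-1 (B * hi).
Proof.
move=> h y /refineP[x [/h hx [[-> hx2]|[i [-> hx2]]]]] /=.
  by rewrite le_max hx2.
have /andP[_ ph] := phi i; have /andP[p0 _] := p01 i.
move: hx; rewrite le_max leNgt hx2 /= => xB.
rewrite le_max; apply/orP; right; apply: ler_pM => //; last exact: ltW.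
by apply: le_trans (ltW hx2); rewrite invr_ge0.
Qed.

Lemma iter_refine_large k c : large_pieces c -> large_pieces (iter k refine c).
Proof. by move=> h; elim: k => //= k IH; apply: refine_large. Qed.

Lemma iter_refine_covers k c : covers c -> covers (iter k refine c).
Proof. by move=> h; elim: k => //= k IH; apply: refine_covers. Qed.

Lemma iter_refine_le (B : R) k c : (forall x, x \in c -> x.1 <= B) ->
  forall x, x \in iter k refine c -> x.1 <= Num.max 2^-1 (B * hi ^+ k).
Proof.
move=> h; elim: k => [|k IH] x /=.
  by move=> /h xB; rewrite expr0 mulr1 le_max xB orbT.
by rewrite exprSr mulrA; apply: refine_le.
Qed.

Lemma iter_refine_good (B : R) k c : large_pieces c -> covers c ->
  (forall x, x \in c -> x.1 <= B) -> B * hi ^+ k <= 2^-1 ->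
  good (iter k refine c).
Proof.
move=> h1 h2 h3 h4; split.
- exact: iter_refine_large.
- by move=> x /(iter_refine_le h3); rewrite (max_idPl _).
- exact: iter_refine_covers.
Qed.

Lemma head_symbolP x z : x.1 <= 2^-1 -> Lip p q x.1 x.2 -> x.2 z 0%N = head_symbol x.
Proof. by move=> h; apply: Lip_head => //; apply: le_lt_trans h _; lra. Qed.

(** Every piece is counted in exactly one zoom. *)
Lemma zoom_mass c : \sum_j q j * mass (zoom j c) = mass c.
Proof.
rewrite /mass (partition_big head_symbol predT)//=; apply: eq_bigr => j _.
rewrite big_map big_filter mulr_sumr; apply: eq_bigr => x _ /=.
by have /andP[q0 _] := q01 j; rewrite mulrC divfK// gt_eqF.
Qed.

Lemma zoom_covers c j : good c -> covers (zoom j c).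
Proof.
move=> [h1 h2 h3] y; have [x [z [xc xy]]] := h3 (scons j y).
exists (x.1 / q j, @stail _ \o x.2), z; split; last by rewrite /= xy.
apply/mapP; exists x => //; rewrite mem_filter xc andbT.
have [_ hL] := h1 _ xc.
by rewrite -(head_symbolP z (h2 _ xc) hL) xy.
Qed.

Lemma zoom_large c j : good c -> large_pieces (zoom j c).
Proof.
move=> [h1 h2 _] y /mapP[x]; rewrite mem_filter => /andP[/eqP hx xc] -> /=.
have [xlo xL] := h1 _ xc; have /andP[q0 q1] := q01 j.
split; last by apply: Lip_stail => // z; rewrite head_symbolP// h2.
apply: le_trans xlo _; rewrite ler_pdivlMr// ler_piMr ?(ltW q1)//.
by apply: le_trans _ (h1 _ xc).1; rewrite divr_ge0// ltW.
Qed.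

Lemma zoomr_good c j : good c -> good (zoomr j c).
Proof.
move=> gc; have q0 : 0 < q j by case/andP: (q01 j).
apply: (@iter_refine_good ((2^-1) / q j)).
- exact: zoom_large.
- exact: zoom_covers.
- move=> y /mapP[x]; rewrite mem_filter => /andP[_ xc] -> /=.
  by rewrite ler_pM2r ?invr_gt0//; case: gc => _ + _; apply.
- rewrite -mulrA ler_piMr ?invr_ge0// mulrC ler_pdivrMr// mul1r.
  exact: le_trans hM _.
Qed.

(** Traces a piece back to the covering it comes from; the bound on the length of
    [u] leaves finitely many words. *)
Lemma zoomr_desc c j y : good c -> y \in zoomr j c -> exists x u,
  [/\ x \in c, (size u <= M)%N, y.1 = x.1 * wordwt p u / q j &
      forall z, x.2 (wcat u z) = scons j (y.2 z)].
Proof.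
move=> [h1 h2 _]; rewrite /zoomr; elim: M y => [|k IH] y /=.
  move=> /mapP[x]; rewrite mem_filter => /andP[/eqP hx xc] -> /=.
  exists x, [::]; split => //; first by rewrite /wordwt big_nil mulr1.
  by move=> z /=; rewrite -hx -(head_symbolP z (h2 _ xc) (h1 _ xc).2) scons_stail.
move=> /refineP[x [/IH [x' [u [x'c su e1 e2]]] [[-> _]|[i [-> _]]]]] /=.
  by exists x', u; split => //; apply: leq_trans su _.
exists x', (rcons u i); split => //.
- by rewrite size_rcons.
- by rewrite e1 /wordwt -cats1 big_cat big_seq1 /= !mulrA mulrAC.
- by move=> z; rewrite wcat_rcons e2.
Qed.

Lemma zoomw_good w c : good c -> good (zoomw w c).
Proof. by elim: w c => //= j w IH c gc; apply: IH; apply: zoomr_good. Qed.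

Lemma zoomw_desc w c y : good c -> y \in zoomw w c -> exists x u,
  [/\ x \in c, (size u <= M * size w)%N,
      y.1 = x.1 * wordwt p u / wordwt q w &
      forall z, x.2 (wcat u z) = wcat w (y.2 z)].
Proof.
elim: w c => [|j w IH] c gc /=.
  by move=> yc; exists y, [::]; split => //; rewrite /wordwt !big_nil mulr1 divr1.
move=> /(IH _ (zoomr_good j gc)) [x [u [xc su e1 e2]]].
have [x' [u' [xc' su' e1' e2']]] := zoomr_desc gc xc.
exists x', (u' ++ u); split => //.
- by rewrite size_cat mulnS leq_add.
- rewrite e1 e1' /wordwt big_cat big_cons /= invfM.
  by rewrite -!mulrA; congr (_ * (_ * _)); rewrite mulrCA.
- by move=> z; rewrite wcat_cat e2' e2.
Qed.

(** Choosing the symbol [i] at every subdivision makes the weight of the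
    descendant explicit. *)
Lemma zoomr_follow c x i : x \in c -> exists y b,
  y \in zoomr (head_symbol x) c /\ y.1 = x.1 * p i ^+ b / q (head_symbol x).
Proof.
move=> xc; rewrite /zoomr; elim: M => [|k [y [b [yc e]]]] /=.
  exists (x.1 / q (head_symbol x), @stail _ \o x.2), 0%N.
  by rewrite /= expr0 mulr1; split => //; apply/mapP; exists x => //;
     rewrite mem_filter eqxx.
have [hy|hy] := leP y.1 2^-1.
  exists y, b; split => //; apply/flatten_mapP; exists y => //.
  by rewrite /split_piece hy inE.
exists (y.1 * p i, y.2 \o scons i), b.+1; split.
  apply/flatten_mapP; exists y => //; rewrite /split_piece leNgt hy /=.
  by apply/mapP; exists i => //; rewrite mem_enum.
by rewrite /= e exprSr !mulrA mulrAC.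
Qed.

End Coverings.

(** * Coverings of least total weight *)

Section Minimal.
Variables (R : realType) (m n : nat) (p : 'I_m -> R) (q : 'I_n -> R).
Hypothesis p01 : forall i, 0 < p i < 1.
Hypothesis q01 : forall j, 0 < q j < 1.
Hypothesis sp : \sum_i p i = 1.
Hypothesis sq : \sum_j q j = 1.
Variables (i0 : 'I_m) (j0 : 'I_n).
Variables lo hi qlo : R.
Hypothesis lo0 : 0 < lo.
Hypothesis lo1 : lo <= 1.
Hypothesis hi01 : 0 < hi < 1.
Hypothesis phi : forall i, lo <= p i <= hi.
Hypothesis qlo0 : 0 < qlo.
Hypothesis qge : forall j, qlo <= q j.
Variable M : nat.
Hypothesis hM : hi ^+ M <= qlo.

Notation good := (@good R m n p q lo).
Notation config := (seq (piece R m n)).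
Let d : piece R m n := (2^-1, fun _ _ => j0).

Lemma size_le_mass (c : config) : good c -> (size c)%:R <= mass c / (lo / 2).
Proof.
move=> [h _ _]; rewrite ler_pdivlMr ?divr_gt0// /mass.
rewrite -sum1_size natr_sum mulr_suml !big_seq.
by apply: ler_sum => x /h [hx _]; rewrite mul1r.
Qed.

Variable U : set_system nat.
Hypothesis UU : UltraFilter U.
Hypothesis Ufree : forall k, U [set i | (k <= i)%N].

Definition config_lim (cs : nat -> config) (c : config) : Prop :=
  [/\ U [set k | size (cs k) = size c],
      forall l e, 0 < e -> U [set k | `|(nth d (cs k) l).1 - (nth d c l).1| < e] &
      forall l z t, U [set k | agree t ((nth d (cs k) l).2 z) ((nth d c l).2 z)]].

Lemma nth_bounds (c : config) l : good c -> lo / 2 <= (nth d c l).1 <= 2^-1.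
Proof.
move=> [h1 h2 _]; have [lc|lc] := ltnP l (size c); last first.
  rewrite nth_default//= lexx andbT; have := lo1; lra.
by rewrite (h1 _ (mem_nth _ lc)).1 h2// mem_nth.
Qed.

Lemma nth_Lip (c : config) l : good c -> (l < size c)%N ->
  Lip p q (nth d c l).1 (nth d c l).2.
Proof. by move=> [h _ _] lc; have [] := h _ (mem_nth d lc). Qed.

(** Bounded total weight bounds the number of pieces, which is therefore constant
    along [U]; weights and values then converge one by one. *)
Lemma config_lim_ex (cs : nat -> config) (B : R) : (forall k, good (cs k)) ->
  (forall k, mass (cs k) <= B) -> exists c, config_lim cs c.
Proof.
move=> gcs tB.
have [N hN] : exists N, U [set k | size (cs k) = N].
  apply: (@ultra_const_nat U UU _ (Num.truncn (B / (lo / 2)))).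
  apply: ultraT => k /=; rewrite truncn_ge_nat.
    apply: le_trans (size_le_mass (gcs k)) _.
    by rewrite ler_pM2r ?invr_gt0 ?divr_gt0.
  have := gcs k; case=> h _ _.
  apply: divr_ge0; last by rewrite divr_ge0// ltW.
  apply: le_trans (tB k); rewrite /mass big_seq; apply: sumr_ge0 => x /h [hx _].
  by apply: le_trans hx; rewrite divr_ge0// ltW.
have /choice[al alP] : forall l, exists a, lo / 2 <= a <= 2^-1 /\
    forall e, 0 < e -> U [set k | `|(nth d (cs k) l).1 - a| < e].
  by move=> l; apply: (ultra_real UU) => k; apply: nth_bounds.
have /choice[f fP] : forall lz : nat * (nat -> 'I_m), exists x,
    forall t, U [set k | agree t ((nth d (cs k) lz.1).2 lz.2) x].
  by move=> [l z]; apply: ultra_seq.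
exists (mkseq (fun l => (al l, fun z => f (l, z))) N); split.
- by rewrite size_mkseq.
- move=> l e e0; have [lN|lN] := ltnP l N.
    by rewrite nth_mkseq//; apply: (alP l).2.
  rewrite [nth _ (mkseq _ _) _]nth_default ?size_mkseq//.
  by apply: ultraS hN => k /= hk; rewrite nth_default ?hk// subrr normr0.
- move=> l z t; have [lN|lN] := ltnP l N.
    by rewrite nth_mkseq//; apply: (fP (l, z)).
  rewrite [nth _ (mkseq _ _) _]nth_default ?size_mkseq//.
  by apply: ultraS hN => k /= hk; rewrite nth_default ?hk.
Qed.

(** Points of a cylinder that are hit along the ultrafilter are hit in the
    limit: this is compactness of the source, made uniform by the common
    Lipschitz bound. *)
Lemma config_lim_hit cs c (Q : set nat) (t : nat -> nat) y :
  (forall k, good (cs k)) -> config_lim cs c ->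
  U [set k | exists l z, [/\ (l < size (cs k))%N, Q l &
                          agree (t k) ((nth d (cs k) l).2 z) y]] ->
  exists l z, [/\ (l < size c)%N, Q l &
     forall s, U [set k | (s <= t k)%N] -> agree s ((nth d c l).2 z) y].
Proof.
move=> gcs [hs _ hf] hit.
have /choice[lz lzP] : forall k, exists lz : nat * (nat -> 'I_m),
   (exists l z, [/\ (l < size (cs k))%N, Q l &
                          agree (t k) ((nth d (cs k) l).2 z) y]) ->
   [/\ (lz.1 < size (cs k))%N, Q lz.1 & agree (t k) ((nth d (cs k) lz.1).2 lz.2) y].
  move=> k; have [[l [z h]]|h] := pselect (exists l z, [/\ (l < size (cs k))%N, Q l &
                          agree (t k) ((nth d (cs k) l).2 z) y]).
    by exists (l, z).
  by exists (0%N, fun=> i0).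
have [l hl] : exists l, U [set k | (lz k).1 = l].
  apply: (@ultra_const_nat U UU _ (size c)).
  by apply: ultraS (ultraI UU hs hit) => k /= [<- /lzP[/ltnW]].
have [z hz] := ultra_seq UU (fun k => (lz k).2).
have hlz : U [set k | [/\ (l < size c)%N, Q l & agree (t k) ((nth d (cs k) l).2 (lz k).2) y]].
  by apply: ultraS (ultraI UU (ultraI UU hs hit) hl) => k /= [[<- /lzP h] <-].
have [k0 /= [lc Ql _]] := ultra_ex UU hlz.
exists l, z; split => // s st.
have [K hK] := Lip_unif p01 q01 2^-1 s.
have [k /= [[[[hk1 hk2] hk3] hk4] [hk5 hk6]]] := ultra_ex UU
  (ultraI UU (ultraI UU (ultraI UU (ultraI UU hs st) (hz K)) (hf l z s)) (ultraI UU hlz (Ufree 0))).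
case: hk5 => _ _ hk5.
apply: agree_trans (agreeW hk2 hk5); apply: agree_trans (agree_sym hk4) _.
apply: agree_sym; apply: hK hk3; last by apply: nth_Lip; rewrite // hk1.
by case/andP: (nth_bounds l (gcs k)).
Qed.

(** The strict inequality in the Lipschitz condition survives a small change of
    the weight, and covering the target is a closed condition. *)
Lemma config_lim_good cs c : (forall k, good (cs k)) -> config_lim cs c -> good c.
Proof.
move=> gcs hlim; have [hs hw hf] := hlim.
have hb l : lo / 2 <= (nth d c l).1 <= 2^-1.
  apply/andP; split; rewrite leNgt; apply/negP => h.
    have e0 : 0 < lo / 2 - (nth d c l).1 by rewrite subr_gt0.
    have [k /=] := ultra_ex UU (hw l _ e0).
    by have := nth_bounds l (gcs k); rewrite ltr_distl; lra.
  have e0 : 0 < (nth d c l).1 - 2^-1 by rewrite subr_gt0.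
  have [k /=] := ultra_ex UU (hw l _ e0).
  by have := nth_bounds l (gcs k); rewrite ltr_distl; lra.
split.
- move=> x xc; rewrite -(nth_index d xc); set l := index x c.
  have lc : (l < size c)%N by rewrite index_mem.
  split; first by case/andP: (hb l).
  move=> s t z z' zz lt.
  have e0 : 0 < wt q ((nth d c l).2 z) t - (nth d c l).1 * wt p z s by rewrite subr_gt0.
  have [k /= [[[h1 h2] h3] h4]] := ultra_ex UU
    (ultraI UU (ultraI UU (ultraI UU hs (hw l _ e0)) (hf l z t.+1)) (hf l z' t.+1)).
  apply: agree_trans (agree_sym h3) _; apply: agree_trans h4.
  apply: (@nth_Lip _ l (gcs k)) zz _; first by rewrite h1.
  rewrite (wt_agree q (agreeW (leqnSn t) h3)).
  have w0 := wt_gt0 p01 z s; have w1 := wt_le1 p01 z s.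
  move: h2; rewrite ltr_distl => /andP[_ h2].
  set a := (nth d (cs k) l).1 in h2 *; set b := (nth d c l).1 in h2 e0 *.
  set W := wt q _ _ in h2 e0 *.
  apply: (@lt_le_trans _ _ ((b + (W - b * wt p z s)) * wt p z s)).
    by rewrite ltr_pM2r.
  rewrite mulrDl -lerBrDl; apply: ler_piMr => //; exact: ltW.
- by move=> x xc; rewrite -(nth_index d xc); case/andP: (hb (index x c)).
- move=> y; have [|l [z [lc _ h]]] := @config_lim_hit cs c setT id y gcs hlim.
    apply: ultraT => k /=; have [_ _ hc] := gcs k.
    have [x [z [xc xz]]] := hc y.
    by exists (index x (cs k)), z; rewrite index_mem nth_index// xz.
  exists (nth d c l), z; split; first exact: mem_nth.
  by apply: agree_all => s; apply: h; apply: Ufree.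
Qed.

Lemma config_lim_mass cs c e : config_lim cs c -> 0 < e ->
  U [set k | `|mass (cs k) - mass c| < e].
Proof.
move=> [hs hw _] e0.
have e1 : 0 < e / (size c).+1%:R by rewrite divr_gt0.
apply: ultraS (ultraI UU hs (ultra_all UU (fun l : 'I_(size c) => hw l _ e1))) => k /= [h1 h2].
rewrite /mass (big_nth d) [X in _ - X](big_nth d) h1 !big_mkord -sumrB.
apply: le_lt_trans (ler_norm_sum _ _ _) _.
apply: (@le_lt_trans _ _ (\sum_(l < size c) (e / (size c).+1%:R))).
  by apply: ler_sum => l _; apply/ltW/h2.
rewrite sumr_const card_ord -[_ *+ size c]mulr_natr mulrAC ltr_pdivrMr// ltr_pM2l// ltr_nat.
exact: ltnSn.
Qed.

Definition minimal (c : config) : Prop :=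
  good c /\ forall c', good c' -> mass c <= mass c'.

(** A limit of coverings whose total weights tend to the infimum. *)
Lemma minimal_ex c : good c -> exists c', minimal c'.
Proof.
move=> gc; pose S := [set mass c' | c' in [set c' | good c']].
have tge0 c' : good c' -> 0 <= mass c'.
  move=> [h _ _]; rewrite /mass big_seq; apply: sumr_ge0 => x /h [hx _].
  by apply: le_trans hx; rewrite divr_ge0// ltW.
have iS : has_inf S.
  split; first by exists (mass c), c.
  by exists 0 => _ [c' /tge0 h <-].
have /choice[cs csP] : forall k, exists c', good c' /\ mass c' < inf S + k.+1%:R^-1.
  move=> k; have e0 : 0 < k.+1%:R^-1 :> R by rewrite invr_gt0.
  by have [_ [c' gc' <-] lt] := inf_adherent e0 iS; exists c'.
have gcs k : good (cs k) by case: (csP k).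
have [|c' hlim] := @config_lim_ex cs (inf S + 1) gcs.
  move=> k; apply: le_trans (ltW (csP k).2) _; rewrite lerD2l invf_le1// ler1n.
  by [].
exists c'; split; first exact: config_lim_good hlim.
move=> c2 gc2; have infle : inf S <= mass c2 by apply: ge_inf; [case: iS|exists c2].
apply: le_trans infle; rewrite leNgt; apply/negP => lt.
have e0 : 0 < (mass c' - inf S) / 2 by rewrite divr_gt0// subr_gt0.
have [K hK] : exists K : nat, K.+1%:R^-1 < (mass c' - inf S) / 2.
  exists (Num.truncn ((mass c' - inf S) / 2)^-1).
  by rewrite -[ltRHS]invrK ltf_pV2 ?posrE ?invr_gt0// truncnS_gt.
have [k /= [h1 h2]] := ultra_ex UU (ultraI UU (Ufree K) (config_lim_mass hlim e0)).
have [_ h3] := csP k.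
have h4 : k.+1%:R^-1 <= K.+1%:R^-1 :> R by rewrite lef_pV2 ?posrE// ler_nat.
move: h2; rewrite ltr_distl => /andP[h2 _].
set a := k.+1%:R^-1 in h3 h4; set b := K.+1%:R^-1 in hK h4; lra.
Qed.

Notation zoomr := (@zoomr R m n p q i0 M).
Notation zoomw := (@zoomw R m n p q i0 M).

Let zoomr_good' := @zoomr_good R m n p q p01 q01 i0 lo hi qlo lo0 phi qge M hM.
Let zoomw_desc' := @zoomw_desc R m n p q p01 q01 i0 lo hi qlo lo0 phi qge M hM.

Lemma zoomr_mass c j : mass (zoomr j c) = mass (zoom q i0 j c).
Proof. by rewrite iter_refine_mass. Qed.

(** The total weight is the average of the total weights of the zooms, so all
    zooms of a minimal covering have the same, least, total weight. *)
Lemma minimal_zoomr j c : minimal c ->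
  minimal (zoomr j c) /\ mass (zoomr j c) = mass c.
Proof.
move=> [gc hc]; suff e : mass (zoomr j c) = mass c.
  by split => //; split; [apply: zoomr_good'|move=> c' /hc; rewrite e].
have ge i : 0 <= q i * (mass (zoomr i c) - mass c).
  have /andP[/ltW q0 _] := q01 i.
  by rewrite mulr_ge0// subr_ge0 hc//; apply: zoomr_good'.
have : \sum_i q i * (mass (zoomr i c) - mass c) = 0.
  under eq_bigr do rewrite mulrBr zoomr_mass.
  by rewrite sumrB zoom_mass// -mulr_suml sq mul1r subrr.
move=> /psumr_eq0P => /(_ (fun i _ => ge i)) /(_ j isT) /eqP.
have /andP[q0 _] := q01 j.
by rewrite mulf_eq0 gt_eqF//= subr_eq0 => /eqP.
Qed.

Lemma minimal_zoomw w c : minimal c ->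
  minimal (zoomw w c) /\ mass (zoomw w c) = mass c.
Proof.
elim: w c => //= j w IH c /(minimal_zoomr j) [mc e].
by have [mc' e'] := IH _ mc; rewrite e' e.
Qed.

Lemma mass_gt0 c : good c -> 0 < mass c.
Proof.
move=> [h1 h2 h3]; have [x [z [xc _]]] := h3 (fun=> j0).
rewrite /mass (big_rem x)//=.
have h0 : 0 < lo / 2 by rewrite divr_gt0.
apply: ltr_wpDr; last by apply: lt_le_trans h0 (h1 _ xc).1.
rewrite big_seq; apply: sumr_ge0 => y /mem_rem /h1 [hy _].
by apply: le_trans hy; apply: ltW.
Qed.

(** Otherwise deleting the piece would leave a good covering of smaller total
    weight. *)
Lemma minimal_irredundant c l : minimal c -> (l < size c)%N ->
  exists y, forall l' z, (l' < size c)%N -> l' <> l -> (nth d c l').2 z <> y.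
Proof.
move=> [gc hc] lc; apply: contrapT => hn.
have [h1 h2 _] := gc.
pose c' := take l c ++ drop l.+1 c.
have sub x : x \in c' -> x \in c by rewrite mem_cat => /orP[/mem_take|/mem_drop].
have : mass c <= mass c'.
  apply: hc; split; [by move=> x /sub /h1|by move=> x /sub /h2|move=> y].
  apply: contrapT => hy; apply: hn; exists y => l' z l'c ne e; apply: hy.
  exists (nth d c l'), z; split => //; rewrite mem_cat.
  have [ll|ll] := ltnP l' l.
    by rewrite -(nth_take d ll) mem_nth// size_take lc.
  have {}ll : (l < l')%N by rewrite ltn_neqAle ll andbT; apply/eqP => E; apply: ne.
  apply/orP; right; rewrite -(subnKC ll) -nth_drop mem_nth// size_drop ltn_sub2r//.
  exact: leq_ltn_trans ll _.
have -> : mass c = mass c' + (nth d c l).1.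
  rewrite /mass -[in LHS](cat_take_drop l c) (drop_nth d lc) !big_cat big_cons /=.
  by rewrite -addrA [X in _ + X]addrC.
apply/negP; rewrite -ltNge ltrDl.
by apply: lt_le_trans (h1 _ (mem_nth d lc)).1; rewrite divr_gt0.
Qed.

(** Given a sequence of minimal coverings with a marked piece in each, some
    cylinder of the target is reached in infinitely many of them only through
    the marked piece. The total weight of the zoom onto it then determines the
    weight of the marked piece up to finitely many possibilities. *)
Lemma marked_weight_const (cs : nat -> config) (x : nat -> piece R m n) (H : R) :
  (forall k, minimal (cs k)) -> (forall k, mass (cs k) = H) ->
  (forall k, x k \in cs k) -> exists a, U [set k | (x k).1 = a].
Proof.
move=> mcs mH xcs; have gcs k : good (cs k) by case: (mcs k).
have [c hlim] : exists c, config_lim cs c.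
  by apply: (@config_lim_ex cs H gcs) => k; rewrite mH.
have gc := config_lim_good gcs hlim.
have mc : mass c = H.
  apply/eqP; apply: contrapT => /negP; rewrite -subr_eq0 -normr_gt0 => e0.
  have [k /=] := ultra_ex UU (config_lim_mass hlim e0).
  by rewrite mH distrC ltxx.
have minc : minimal c by split => // c' gc'; rewrite mc -(mH 0%N); apply: (mcs 0%N).2.
have [hs _ _] := hlim.
have [l hl] : exists l, U [set k | index (x k) (cs k) = l].
  apply: (@ultra_const_nat U UU _ (size c)); apply: ultraS hs => k /= <-.
  exact: index_size.
have [lc hls] : (l < size c)%N /\ U [set k | size (cs k) = size c].
  split => //; have [k /= [<- <-]] := ultra_ex UU (ultraI UU hs hl).
  by rewrite index_mem.
(* A point which only the marked piece of the limit covering reaches. *)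
have [y hy] := minimal_irredundant minc lc.
(* The other pieces have closed images, so they miss a whole cylinder. *)
have [t ht] : exists t, forall l' z, (l' < size c)%N -> l' <> l ->
    ~ agree t ((nth d c l').2 z) y.
  apply: contrapT => hn.
  have limc : config_lim (fun=> c) c.
    split; first exact: ultraT.
      by move=> l' e e0; apply: ultraT => k /=; rewrite subrr normr0.
    by move=> l' z t; apply: ultraT.
  have [|l' [z [l'c Ql h]]] := @config_lim_hit _ _ [set l' | l' <> l] id y (fun=> gc) limc.
    apply: ultraT => t /=; apply: contrapT => hn2; apply: hn; exists t => l' z l'c ne ag.
    by apply: hn2; exists l', z.
  apply: (hy l' z l'c Ql); apply: agree_all => s; apply: h; exact: Ufree.
(* By convergence the same cylinder is missed along [U]. *)
have hU : U [set k | forall l' z, (l' < size (cs k))%N -> l' <> l ->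
    ~ agree t ((nth d (cs k) l').2 z) y].
  case: (in_ultra_setVsetC [set k | forall l' z, (l' < size (cs k))%N -> l' <> l ->
    ~ agree t ((nth d (cs k) l').2 z) y] UU) => // hC; exfalso.
  have [|l' [z [l'c Ql h]]] := @config_lim_hit _ _ [set l' | l' <> l] (fun=> t) y gcs hlim.
    apply: ultraS hC => k /= hk; apply: contrapT => hn; apply: hk => l' z l'c ne ag.
    by apply: hn; exists l', z.
  by apply: (ht l' z l'c Ql); apply: h; apply: ultraT => k /=.
pose w := mkseq y t.
pose B1 := (M * size w)%N; pose B2 := Num.truncn (H / (lo / 2)).
have /choice[us usP] : forall k, exists us : B2.-bseq (B1.-bseq 'I_m),
    U [set k | forall l' z, (l' < size (cs k))%N -> l' <> l ->
      ~ agree t ((nth d (cs k) l').2 z) y] ->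
    (forall l' z, (l' < size (cs k))%N -> l' <> l ->
      ~ agree t ((nth d (cs k) l').2 z) y) /\ index (x k) (cs k) = l ->
    H * wordwt q w = (x k).1 * \sum_(u <- us) wordwt p u.
  move=> k; have [[h1 h2]|hn] := pselect ((forall l' z, (l' < size (cs k))%N -> l' <> l ->
      ~ agree t ((nth d (cs k) l').2 z) y) /\ index (x k) (cs k) = l); last first.
    by exists [bseq] => _ /hn.
  have [mz ez] := minimal_zoomw w (mcs k).
  have gz : good (zoomw w (cs k)) by case: mz.
  have /choice[u uP] : forall v, exists u : B1.-bseq 'I_m, v \in zoomw w (cs k) ->
      v.1 = (x k).1 * wordwt p u / wordwt q w.
    move=> v; have [vz|vz] := boolP (v \in zoomw w (cs k)); last by exists [bseq].
    have [x' [u [x'c su e1 e2]]] := zoomw_desc' (gcs k) vz.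
    exists (Bseq su) => _; rewrite e1 /=; congr (_.1 * _ / _).
    have := nth_index d x'c; have := index_mem x' (cs k); rewrite x'c => il.
    have [E|ne] := pselect (index x' (cs k) = l).
      by rewrite E -h2 nth_index.
    move=> E; exfalso; apply: (h1 _ (wcat u (fun=> i0)) il ne); rewrite E e2.
    exact: wcat_mkseq.
  have su : (size (map u (zoomw w (cs k))) <= B2)%N.
    rewrite size_map truncn_ge_nat.
      by have := size_le_mass gz; rewrite ez mH.
    by rewrite divr_ge0// ?divr_ge0 ?ltW// -(mH k); apply: mass_gt0.
  exists (Bseq su) => _ _ /=; have wq0 := wordwt_gt0 q01 w.
  rewrite -(mH k) -ez /mass big_map mulr_suml mulr_sumr !big_seq.
  by apply: eq_bigr => v vz; rewrite uP// divfK// gt_eqF.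
have [us0 hus] := ultra_const UU us.
exists (H * wordwt q w / \sum_(u <- us0) wordwt p u).
apply: ultraS (ultraI UU (ultraI UU hU hl) hus) => k /= [[h1 h2] <-].
have e := usP k hU (conj h1 h2).
have H0 : 0 < H by rewrite -(mH k); apply: mass_gt0.
rewrite e mulfK//; apply/eqP => E; move: e; rewrite E mulr0 => /eqP.
by rewrite mulf_eq0 !gt_eqF// wordwt_gt0.
Qed.

(** Following the point whose coding repeats the symbol [i] through successive
    zooms produces infinitely many marked pieces; two of them have the same
    weight, which is a multiplicative relation. *)
Lemma source_relation c i : minimal c -> exists a a' w w',
  (a < a')%N /\ p i ^+ a' * wordwt q w = p i ^+ a * wordwt q w'.
Proof.
move=> mc; have [gc _] := mc; have [x0 [z0 [x0c _]]] : exists x z, x \in c /\ x.2 z = fun=> j0.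
  by case: gc => _ _; apply.
have /andP[pi0 pi1] := p01 i.
(* A covering, its marked piece, the exponent of [p i] accumulated so far and
   the target word already zoomed into. *)
pose St := (config * piece R m n * nat * seq 'I_n)%type.
pose inv (s : St) := [/\ minimal s.1.1.1, mass s.1.1.1 = mass c, s.1.1.2 \in s.1.1.1 &
   s.1.1.2.1 * wordwt q s.2 = x0.1 * p i ^+ s.1.2].
have /choice[step stepP] : forall s : St, exists s' : St, inv s ->
    inv s' /\ size s'.2 = (size s.2).+1.
  move=> [[[c1 x1] a1] w1]; have [[/= mc1 mm1 xc1 e1]|hn] := pselect (inv (c1, x1, a1, w1)); last first.
    by exists (c1, x1, a1, w1) => /hn.
  have [y [b [yc e]]] := zoomr_follow p q i0 M i xc1.
  exists (zoomr (head_symbol i0 x1) c1, y, (a1 + b)%N, head_symbol i0 x1 :: w1) => _.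
  have [mz ez] := minimal_zoomr (head_symbol i0 x1) mc1.
  split => //; split => //=; first by rewrite ez.
  have /andP[q0 _] := q01 (head_symbol i0 x1).
  rewrite e /wordwt big_cons mulrA divfK ?gt_eqF// exprD mulrA -e1 /wordwt.
  by rewrite mulrAC.
pose s k := iter k step (c, x0, 0%N, [::]).
have sP k : inv (s k) /\ size (s k).2 = k.
  elim: k => [|k [IH1 IH2]] /=.
    by split => //; split => //=; rewrite /wordwt big_nil expr0.
  by have [h1 h2] := stepP _ IH1; split => //; rewrite h2 IH2.
have [al hal] := @marked_weight_const (fun k => (s k).1.1.1) (fun k => (s k).1.1.2) (mass c)
  (fun k => let: And4 h _ _ _ := (sP k).1 in h) (fun k => let: And4 _ h _ _ := (sP k).1 in h)
  (fun k => let: And4 _ _ h _ := (sP k).1 in h).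
have [k1 /= hk1] := ultra_ex UU hal.
have lo20 : 0 < lo / 2 by rewrite divr_gt0.
have x00 : 0 < x0.1 by case: gc => h _ _; apply: lt_le_trans lo20 (h _ x0c).1.
have [qa [qb [/andP[qa0 _] qb01 qab]]] := ratio_bounds q01.
have e0 : 0 < x0.1 * p i ^+ (s k1).1.2 by rewrite mulr_gt0// exprn_gt0.
have [K hK] := expr_lt_eps qb01 e0.
have [k2 /= [hk2 K2]] := ultra_ex UU (ultraI UU hal (Ufree K)).
have [[_ _ _ E1] _] := sP k1.
have [[[gc2 _] _ xc2 E2] S2] := sP k2.
exists (s k1).1.2, (s k2).1.2, (s k1).2, (s k2).2; split.
  rewrite ltnNge; apply/negP => le.
  have : x0.1 * p i ^+ (s k1).1.2 <= x0.1 * p i ^+ (s k2).1.2.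
    by rewrite ler_pM2l// ler_wiXn2l// ltW.
  rewrite -E2; apply/negP; rewrite -ltNge; apply: le_lt_trans hK.
  have wq0 := wordwt_gt0 q01 (s k2).2.
  apply: (@le_trans _ _ (wordwt q (s k2).2)).
    apply: ler_piMl; first exact: ltW.
    by case: gc2 => _ h _; apply: le_trans (h _ xc2) _; lra.
  apply: (@le_trans _ _ (qb ^+ size (s k2).2)).
    rewrite /wordwt; elim: (s k2).2 => [|j w IH]; first by rewrite big_nil expr0.
    rewrite big_cons exprS; apply: ler_pM => //; first by case/andP: (q01 j) => /ltW.
      exact/ltW/(wordwt_gt0 q01).
    by case/andP: (qab j).
  by rewrite S2; apply: ler_wiXn2l => //; case/andP: qb01 => *; apply: ltW.
apply: (mulfI (lt0r_neq0 x00)); rewrite !mulrA -E1 -E2 hk1 hk2.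
by rewrite mulrAC.
Qed.

Lemma exponent_shift g l b : (g <= l <= g + b)%N -> (g + b = l + (b - (l - g)))%N.
Proof. lia. Qed.

(** When the source ratios are powers of one number, the weights occurring in
    the zooms along a repeated symbol take finitely many values up to a common
    power, so that two of these zooms are comparable. *)
Lemma target_relation c (lam : R) (e : 'I_m -> nat) j : 0 < lam < 1 ->
  (forall i, p i = lam ^+ e i) -> minimal c -> exists k k' l l',
  (k < k')%N /\ q j ^+ k' * lam ^+ l = q j ^+ k * lam ^+ l'.
Proof.
move=> /andP[l0 l1] pe mc; have gc : good c by case: mc.
have lo20 : 0 < lo / 2 by rewrite divr_gt0.
have [qj0 qj1] := andP (q01 j).
have wpw u : exists E, wordwt p u = lam ^+ E.
  elim: u => [|i u [E hE]]; first by exists 0%N; rewrite /wordwt big_nil expr0.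
  by exists (e i + E)%N; rewrite /wordwt big_cons -/(wordwt p u) hE pe exprD.
pose cs k := zoomw (nseq k j) c.
have mcs k : minimal (cs k) /\ mass (cs k) = mass c by apply: minimal_zoomw.
have wq k : wordwt q (nseq k j) = q j ^+ k.
  by elim: k => [|k IH]; rewrite /wordwt ?big_nil// big_cons exprS -IH.
have /choice[E EP] : forall kv : nat * piece R m n, exists lE : nat * nat,
    kv.2 \in cs kv.1 -> (lE.1 < size c)%N /\
      kv.2.1 * q j ^+ kv.1 = (nth d c lE.1).1 * lam ^+ lE.2.
  move=> [k v] /=; have [vc|vc] := boolP (v \in cs k); last by exists (0%N, 0%N).
  have [x [u [xc _ e1 _]]] := zoomw_desc' gc vc.
  have [F hF] := wpw u; exists (index x c, F) => _ /=; rewrite index_mem xc nth_index//.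
  split => //; rewrite e1 hF wq divfK// expf_eq0 negb_and gt_eqF// orbT//.
have le0 : 0 < lo * lo by rewrite mulr_gt0.
have [B hB] := expr_lt_eps (andb_true_intro (conj l0 l1)) le0.
(* All weights in one zoom are comparable, hence so are the exponents. *)
have diff k v v' : v \in cs k -> v' \in cs k -> ((E (k, v)).2 <= (E (k, v')).2 + B)%N.
  move=> vc v'c; have gk : good (cs k) by case: (mcs k) => -[].
  have [s1 e1] := EP (k, v) vc; have [s2 e2] := EP (k, v') v'c.
  rewrite leqNgt; apply/negP => lt.
  have := nth_bounds (E (k, v)).1 gc; have := nth_bounds (E (k, v')).1 gc.
  move: e1 e2 => /=; set a := (nth _ _ _).1; set b := (nth _ _ _).1.
  move=> e1 e2 /andP[b1 b2] /andP[a1 a2].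
  have vb : lo / 2 <= v.1 by case: gk => h _ _; apply: (h v vc).1.
  have vb' : v'.1 <= 2^-1 by case: gk => _ h _; apply: h.
  set g := (E (k, v)).2 in lt e1; set g' := (E (k, v')).2 in lt e2.
  have Q0 : 0 < q j ^+ k by rewrite exprn_gt0.
  set Q := q j ^+ k in e1 e2 Q0.
  have G0 : 0 < lam ^+ g' by rewrite exprn_gt0.
  have h3 : lam ^+ g <= lam ^+ g' * lam ^+ B.
    by rewrite -exprD; apply: ler_wiXn2l; [apply: ltW|apply: ltW|apply: ltnW].
  have h4 : lo / 2 * Q <= 2^-1 * (lam ^+ g' * lam ^+ B).
    apply: (@le_trans _ _ (v.1 * Q)); first by rewrite ler_pM2r.
    by rewrite e1; apply: ler_pM => //; [apply: le_trans a1; apply: ltW|rewrite exprn_ge0// ltW].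
  have h5 : lo / 2 * lam ^+ g' <= 2^-1 * Q.
    apply: (@le_trans _ _ (b * lam ^+ g')); first by rewrite ler_pM2r.
    by rewrite -e2 ler_pM2r.
  have h6 : lam ^+ g' * lam ^+ B < lam ^+ g' * (lo * lo) by rewrite ltr_pM2l.
  have h7 : lo * (lo * lam ^+ g') <= lo * Q by rewrite ler_pM2l//; lra.
  move: h4 h6 h7; rewrite [lam ^+ g' * (lo * lo)]mulrC -!mulrA.
  set X := lam ^+ g' * _; set Y := lo * (lo * _); lra.
pose ell k := (\max_(v <- cs k) (E (k, v)).2)%N.
have ellP k v : v \in cs k -> ((E (k, v)).2 <= ell k <= (E (k, v)).2 + B)%N.
  move=> vc; apply/andP; split.
    by rewrite /ell (big_rem v)//= leq_maxl.
  by rewrite /ell; apply/bigmax_leqP_seq => v' v'c _; apply: diff.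
pose B2 := Num.truncn (mass c / (lo / 2)).
have /choice[us usP] : forall k, exists us : B2.-bseq ('I_(size c).+1 * 'I_B.+1)%type,
    mass c * q j ^+ k * lam ^+ B =
    lam ^+ ell k * \sum_(u <- us) (nth d c u.1).1 * lam ^+ (B - u.2).
  move=> k; have gk : good (cs k) by case: (mcs k) => -[].
  (* Exponents are recorded relative to the largest one, the shift by [B]
     keeping them nonnegative. *)
  pose us := map (fun v => (inord (E (k, v)).1 : 'I_(size c).+1,
       inord (ell k - (E (k, v)).2) : 'I_B.+1)) (cs k).
  have su : (size us <= B2)%N.
    rewrite size_map truncn_ge_nat.
      by have := size_le_mass gk; rewrite (mcs k).2.
    by rewrite divr_ge0// ltW// mass_gt0.
  exists (Bseq su) => /=; rewrite /us big_map -(mcs k).2 /mass !mulr_suml mulr_sumr !big_seq.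
  apply: eq_bigr => v vc /=; have [h1 h2] := EP (k, v) vc.
  have /andP[h3 h4] := ellP k v vc.
  rewrite !inordK; [|by rewrite ltnS leq_subLR|by rewrite ltnS ltnW].
  move: h2 => /= ->; rewrite mulrCA -mulrA; congr (_ * _); rewrite -!exprD.
  by congr (_ ^+ _); apply: exponent_shift; rewrite h3 h4.
have [us0 hus] := ultra_const UU us.
have [k /= hk] := ultra_ex UU hus.
have [k' /= [hk' kk']] := ultra_ex UU (ultraI UU hus (Ufree k.+1)).
exists k, k', (ell k), (ell k'); split => //.
have := usP k; have := usP k'; rewrite hk hk'.
set S := \sum_(u <- _) _ => e1 e2.
have m0 : mass c * lam ^+ B != 0 by rewrite mulf_neq0// gt_eqF ?mass_gt0// exprn_gt0.
have S0 : S != 0.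
  apply/eqP => S0; move: e1; rewrite S0 mulr0 mulrAC => /eqP.
  by rewrite mulf_eq0 (negbTE m0)/= expf_eq0 (gt_eqF qj0) andbF.
apply: (mulfI m0); apply: (mulIf S0).
have -> : mass c * lam ^+ B * (q j ^+ k' * lam ^+ ell k) * S =
  (mass c * q j ^+ k' * lam ^+ B) * (lam ^+ ell k * S) by ring.
rewrite e1 -e2; ring.
Qed.

End Minimal.

Section Relations.
Variables (R : realType) (m n : nat) (p : 'I_m -> R) (q : 'I_n -> R).
Hypothesis p01 : forall i, 0 < p i < 1.
Hypothesis q01 : forall j, 0 < q j < 1.
Hypothesis sp : \sum_i p i = 1.
Hypothesis sq : \sum_j q j = 1.
Variables (f : (nat -> 'I_m) -> nat -> 'I_n) (L : R).
Hypothesis fL : Lip p q L f.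
Hypothesis fsurj : forall y, exists z, f z = y.

(** A Lipschitz surjection is, after subdivision, a good covering; hence a minimal
    one exists. *)
Lemma lipschitz_surjection_relations :
  (forall i, exists a a' w w',
    (a < a')%N /\ p i ^+ a' * wordwt q w = p i ^+ a * wordwt q w') /\
  (forall (lam : R) (e : 'I_m -> nat) j, 0 < lam < 1 ->
    (forall i, p i = lam ^+ e i) -> exists k k' l l',
    (k < k')%N /\ q j ^+ k' * lam ^+ l = q j ^+ k * lam ^+ l').
Proof.
have [lo [hi [/andP[lo0 lo1] hi01 phi]]] := ratio_bounds p01.
have [qlo [qhi [/andP[qlo0 _] _ qb]]] := ratio_bounds q01.
have qge j : qlo <= q j by case/andP: (qb j).
have [M /ltW hM] := expr_lt_eps hi01 qlo0.
have i0 : 'I_m.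
  case: (m) p sp => [p0 s0|k *]; last exact: ord0.
  by move: s0; rewrite big_ord0 => /esym /eqP; rewrite oner_eq0.
have j0 : 'I_n.
  case: (n) q sq => [p0 s0|k *]; last exact: ord0.
  by move: s0; rewrite big_ord0 => /esym /eqP; rewrite oner_eq0.
pose B := `|L| + 1.
have B1 : 1 <= B by rewrite /B lerDr.
have e0 : 0 < 2^-1 / B by rewrite divr_gt0//; lra.
have [k hk] := expr_lt_eps hi01 e0.
have gc : good p q lo (iter k (refine p) [:: (B, f)]).
  apply: (@iter_refine_good R m n p q p01 lo hi lo0 phi B) => //.
  - move=> x; rewrite inE => /eqP -> /=; split; first by lra.
    apply: LipW fL => //; apply: le_trans (ler_norm L) _; by rewrite /B lerDl.
  - by move=> y; have [z hz] := fsurj y; exists (B, f), z; rewrite inE eqxx.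
  - by move=> x; rewrite inE => /eqP ->.
  - by rewrite mulrC -ler_pdivlMr ?ltW//; lra.
have [U [UU Ufree]] := free_ultrafilter.
have [c mc] := minimal_ex p01 q01 i0 j0 lo0 (ltW lo1) UU Ufree gc.
split.
- by move=> i; apply: (source_relation p01 q01 sp sq i0 j0 lo0 (ltW lo1) phi qge hM UU Ufree i mc).
- move=> lam e j l01 pe.
  exact: (target_relation p01 q01 sp sq i0 j0 lo0 (ltW lo1) hi01 phi qlo0 qge hM UU Ufree j l01 pe mc).
Qed.

End Relations.

(** * Exchanging two self-similar decompositions *)

Section CharacteristicPolynomial.
Variables (F : comNzRingType) (m : nat) (a : 'I_m -> nat).

(** The polynomial vanishing at [lam] when the weights [lam ^+ a i] add up
    to 1. *)
Definition char_pol : {poly F} := 1 - \sum_i 'X^(a i).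

Lemma coef_char_pol k : (forall i, (0 < a i)%N) ->
  char_pol`_k = (k == 0%N)%:R - (\sum_i (a i == k))%:R.
Proof.
move=> a0; rewrite /char_pol coefB coef1 coef_sum natr_sum; congr (_ - _).
by apply: eq_bigr => i _; rewrite coefXn eq_sym.
Qed.

End CharacteristicPolynomial.

Lemma map_char_pol (F F' : comNzRingType) (f : {rmorphism F -> F'}) m (a : 'I_m -> nat) :
  map_poly f (char_pol F a) = char_pol F' a.
Proof.
rewrite /char_pol rmorphB rmorph1 rmorph_sum; congr (_ - _).
by apply: eq_bigr => i _; rewrite /= map_polyXn.
Qed.

Section Quotient.
Variables (R : realType) (m : nat) (a : 'I_m -> nat) (lam : R).
Hypothesis a0 : forall i, (0 < a i)%N.
Hypothesis lam01 : 0 < lam < 1.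
Hypothesis suma : \sum_i lam ^+ a i = 1.

Lemma root_char_pol : root (char_pol R a) lam.
Proof.
rewrite rootE /char_pol hornerD hornerN hornerC horner_sum.
by under eq_bigr do rewrite hornerXn; rewrite suma subrr.
Qed.

(** Dividing the characteristic polynomial by its linear factor gives, up to
    sign, the tails of the weight sum; in particular all coefficients up to
    the degree are of one sign. *)
Lemma coef_quotient (Z : {poly R}) k : char_pol R a = Z * ('X - lam%:P) ->
  lam ^+ k.+1 * Z`_k = - \sum_(i | (k < a i)%N) lam ^+ a i.
Proof.
move=> eZ; have ck j : (char_pol R a)`_j = (if j == 0%N then 0 else Z`_j.-1) - Z`_j * lam.
  by rewrite eZ mulrBr coefB coefMX coefMC.
elim: k => [|k IH].
  have := ck 0%N; rewrite coef_char_pol//= big1; last first.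
    by move=> i _; apply/eqP; rewrite eqb0 -lt0n.
  rewrite subr0 sub0r expr1 mulrC => h; rewrite -[LHS]opprK -h; congr (- _).
  by rewrite -suma; apply: eq_bigl => i; rewrite a0.
have := ck k.+1; rewrite coef_char_pol//= (_ : (k.+1 == 0%N)%:R = 0)// sub0r => h.
rewrite exprSr -mulrA [lam * _]mulrC.
have -> : Z`_k.+1 * lam = Z`_k + (\sum_i (a i == k.+1))%:R.
  by move: h; set x := _ * lam; set s := _%:R; set z := Z`_k => h; lra.
rewrite mulrDr IH natr_sum mulr_sumr.
have -> : \sum_i lam ^+ k.+1 * (a i == k.+1)%:R = \sum_(i | a i == k.+1) lam ^+ a i.
  rewrite [RHS]big_mkcond; apply: eq_bigr => i _.
  by case: eqP => [->|_]; rewrite ?mulr1 ?mulr0.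
rewrite (bigID (fun i => a i == k.+1) (fun i => (k < a i)%N))/= opprD addrAC.
have -> : \sum_(i | (k < a i)%N && (a i == k.+1)) lam ^+ a i =
          \sum_(i | a i == k.+1) lam ^+ a i.
  by apply: eq_bigl => i; case: eqP => [->|]; rewrite ?ltnSn ?andbF.
rewrite addNr sub0r; congr (- _); apply: eq_bigl => i.
by rewrite [in RHS]ltn_neqAle eq_sym andbC.
Qed.

(** The bound [lam ^+ N] comes from the one term of highest degree in the tail
    sums. *)
Lemma quotient_sign (Z : {poly R}) : char_pol R a = Z * ('X - lam%:P) ->
  exists N, [/\ (0 < N)%N, (size Z <= N)%N &
    forall k, (k < N)%N -> lam ^+ N <= - Z`_k].
Proof.
move=> eZ; pose N := (\max_i a i)%N; have /andP[l0 l1] := lam01.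
have [|i0 ei0] := @bigop.eq_bigmax _ a.
  rewrite card_ord lt0n; apply/eqP => m0.
  move: suma; rewrite big1 => [/eqP|i _]; first by rewrite eq_sym oner_eq0.
  by have := ltn_ord i; rewrite {2}m0.
rewrite -/N in ei0; exists N; split; first by rewrite ei0.
- apply/leq_sizeP => k Nk; have /eqP := coef_quotient k eZ.
  rewrite big_pred0 => [|i]; last first.
    by apply/negbTE; rewrite -leqNgt; apply: leq_trans Nk; exact: (bigop.leq_bigmax i).
  by rewrite oppr0 mulf_eq0 expf_eq0 gt_eqF// andbF => /eqP.
- move=> k kN; apply: (@le_trans _ _ (- (lam ^+ k.+1 * Z`_k))).
    rewrite coef_quotient// opprK (bigD1 i0) -?ei0//= lerDl.
    by apply: sumr_ge0 => i _; rewrite exprn_ge0// ltW.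
  have Z0 : 0 <= - Z`_k.
    have := coef_quotient k eZ; rewrite -(pmulr_rge0 _ (exprn_gt0 k.+1 l0)) mulrN => ->.
    by rewrite opprK; apply: sumr_ge0 => i _; rewrite exprn_ge0// ltW.
  by rewrite -mulrN ler_piMl// exprn_ile1// ltW.
Qed.

End Quotient.

(** The coefficients of [- A * W] below [N] are bounded away from 0 and the others
    vanish for reasons of degree, so that replacing [- W] by a nearby polynomial
    [E - W] of no larger degree keeps all of them nonnegative. *)
Lemma perturbed_product (R : realType) (A W E : {poly R}) N (eta del : R) :
  A != 0 -> W != 0 -> (size (A * W)%R <= N)%N -> (size E <= size W)%N ->
  0 <= eta -> (forall k, `|E`_k| <= eta) ->
  (\sum_(j < size A) `|A`_j|) * eta < del ->
  (forall k, (k < N)%N -> del <= - (A * W)`_k) ->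
  (forall k, 0 <= (A * (E - W))`_k) /\ (forall k, (k < N)%N -> 0 < (A * (E - W))`_k).
Proof.
move=> A0 W0 sAW sE eta0 hE small neg.
have bound k : `|(A * E)`_k| <= (\sum_(j < size A) `|A`_j|) * eta.
  rewrite coefM; apply: le_trans (ler_norm_sum _ _ _) _.
  apply: (@le_trans _ _ (\sum_(j < k.+1) `|A`_j| * eta)).
    by apply: ler_sum => j _; rewrite normrM ler_wpM2l.
  rewrite -mulr_suml; apply: ler_wpM2r => //.
  rewrite -!(big_mkord predT (fun j => `|A`_j|)).
  have [kA|Ak] := leqP k.+1 (size A).
    by rewrite [leRHS](big_cat_nat (leq0n _) kA)//= lerDl; apply: sumr_ge0.
  rewrite (big_cat_nat (leq0n _) (ltnW Ak))//= -[leRHS]addr0 lerD2l big_nat_cond big1//.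
  by move=> j /andP[/andP[/leq_sizeP h _] _]; rewrite h// normr0.
have pos k : (k < N)%N -> 0 < (A * (E - W))`_k.
  move=> kN; have := neg k kN; have := bound k; rewrite mulrBr coefB.
  rewrite ler_norml => /andP[]; lra.
split => // k; have [/pos/ltW//|Nk] := ltnP k N.
rewrite nth_default//; apply: leq_trans Nk; apply: (leq_trans _ sAW).
rewrite [X in (_ <= X)%N]size_mul//; apply: leq_trans (size_polyMleq _ _) _.
rewrite -!subn1 leq_sub2r// leq_add2l.
apply: leq_trans (size_polyD _ _) _; by rewrite size_polyN geq_max sE leqnn.
Qed.

Section Exchange.
Variables (R : realType) (m n : nat) (a : 'I_m -> nat) (b : 'I_n -> nat) (lam : R).
Hypothesis a0 : forall i, (0 < a i)%N.
Hypothesis b0 : forall j, (0 < b j)%N.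
Hypothesis lam01 : 0 < lam < 1.
Hypothesis suma : \sum_i lam ^+ a i = 1.
Hypothesis sumb : \sum_j lam ^+ b j = 1.

Local Notation "p ^r" := (map_poly (ratr : rat -> R) p) (at level 2, format "p ^r").

(** Both characteristic polynomials vanish at [lam], hence so does their
    greatest common divisor [G] over the rationals, and the cofactors of [G],
    multiplied by a rational approximation of the opposite of [G / ('X - lam)],
    solve the equation with nonnegative coefficients. *)
Lemma rational_exchange : exists T S : {poly rat},
  [/\ T * char_pol _ b = S * char_pol _ a, T != 0,
      forall k, 0 <= T`_k & forall k, 0 <= S`_k].
Proof.
have [l0 l1] := andP lam01.
pose PX := char_pol rat a; pose PY := char_pol rat b; pose G := gcdp PX PY.
have neq0 k (c : 'I_k -> nat) : (forall i, (0 < c i)%N) -> char_pol rat c != 0.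
  move=> c0; apply/eqP => /(congr1 (fun P : {poly rat} => P`_0)).
  rewrite coef_char_pol// coef0 big1 => [|i _]; last by apply/eqP; rewrite eqb0 -lt0n.
  by rewrite subr0 => /eqP; rewrite oner_eq0.
have PX0 : PX != 0 by apply: neq0.
have PY0 : PY != 0 by apply: neq0.
pose A := PX %/ G; pose B := PY %/ G.
have eA : PX = A * G by rewrite /A divpK// dvdp_gcdl.
have eB : PY = B * G by rewrite /B divpK// dvdp_gcdr.
have A0 : A != 0 by apply: contra_neq PX0 => A0; rewrite eA A0 mul0r.
have B0 : B != 0 by apply: contra_neq PY0 => B0; rewrite eB B0 mul0r.
have /factor_theorem[W eW] : root G^r lam.
  by rewrite /G gcdp_map root_gcd !map_char_pol !root_char_pol.
have W0 : W != 0.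
  apply: contra_neq PX0 => W0; apply: (map_poly_inj (@ratr R)).
  by rewrite eA rmorphM /= eW W0 !(mul0r, mulr0) rmorph0.
have eAW : char_pol R a = (A^r * W) * ('X - lam%:P).
  by rewrite -mulrA -eW -(map_char_pol (@ratr R)) -/PX eA rmorphM.
have eBW : char_pol R b = (B^r * W) * ('X - lam%:P).
  by rewrite -mulrA -eW -(map_char_pol (@ratr R)) -/PY eB rmorphM.
have [NA [NA0 sA hA]] := quotient_sign a0 lam01 suma eAW.
have [NB [NB0 sB hB]] := quotient_sign b0 lam01 sumb eBW.
pose nA := \sum_(j < size A^r) `|A^r`_j|; pose nB := \sum_(j < size B^r) `|B^r`_j|.
have nA0 : 0 <= nA by apply: sumr_ge0.
have nB0 : 0 <= nB by apply: sumr_ge0.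
pose del := lam ^+ NA * lam ^+ NB.
have pA : 0 < lam ^+ NA by rewrite exprn_gt0.
have pB : 0 < lam ^+ NB by rewrite exprn_gt0.
have del0 : 0 < del by rewrite mulr_gt0.
have delA : del <= lam ^+ NA by rewrite ler_piMr ?ltW// exprn_ilt1 -?lt0n// ltW.
have delB : del <= lam ^+ NB by rewrite ler_piMl ?ltW// exprn_ilt1 -?lt0n// ltW.
pose eta := del / (nA + nB + 1).
have eta0 : 0 < eta by rewrite divr_gt0// ltr_wpDl// addr_ge0.
have small x : x < nA + nB + 1 -> x * eta < del.
  move=> h; rewrite /eta mulrCA gtr_pMr// ltr_pdivrMr ?mul1r//.
  by rewrite ltr_wpDl// addr_ge0.
have /choice[v vP] : forall k, exists v : rat, `|ratr v + W`_k| <= eta.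
  move=> k; have [|v] := @rat_in_itvoo R (- W`_k) (- W`_k + eta).
    by rewrite ltrDl.
  rewrite in_itv /= => /andP[h1 h2]; exists v; rewrite ler_norml; apply/andP; split; lra.
pose V := \poly_(k < size W) v k.
pose E := V^r + W.
have sE : (size E <= size W)%N.
  apply: leq_trans (size_polyD _ _) _.
  by rewrite geq_max leqnn andbT size_map_poly size_poly.
have bE k : `|E`_k| <= eta.
  rewrite /E coefD coef_map coef_poly; case: ltnP => [_|kW]; first exact: vP.
  by rewrite raddf0 add0r nth_default// normr0 ltW.
have VE : V^r = E - W by rewrite /E addrK.
have A0r : A^r != 0 by rewrite map_poly_eq0.
have B0r : B^r != 0 by rewrite map_poly_eq0.
have [pos1 pos1'] := perturbed_product A0r W0 sA sE (ltW eta0) bE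
  (small nA ltac:(lra)) (fun k kN => le_trans delA (hA k kN)).
have [pos2 _] := perturbed_product B0r W0 sB sE (ltW eta0) bE
  (small nB ltac:(lra)) (fun k kN => le_trans delB (hB k kN)).
exists (A * V), (B * V); split.
- by rewrite -/PX -/PY eA {1}eB; ring.
- apply/eqP => AV0; have := pos1' 0%N NA0; rewrite -VE -rmorphM /= AV0.
  by rewrite rmorph0 coef0 ltxx.
- by move=> k; have := pos1 k; rewrite -VE -rmorphM /= coef_map /= ler0q.
- by move=> k; have := pos2 k; rewrite -VE -rmorphM /= coef_map /= ler0q.
Qed.

(** The generating polynomial of a multiset of degrees. *)
Definition seq_pol (s : seq nat) : {poly rat} := \sum_(k <- s) 'X^k.

Lemma coef_seq_pol s k : (seq_pol s)`_k = (count_mem k s)%:R.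
Proof.
rewrite /seq_pol coef_sum -sum1_count natr_sum [RHS]big_mkcond /=.
by apply: eq_bigr => i _; rewrite coefXn eq_sym; case: eqP.
Qed.

Lemma seq_pol_inj s t : seq_pol s = seq_pol t -> perm_eq s t.
Proof.
move=> e; rewrite /perm_eq; apply/allP => k _ /=.
by rewrite -(eqr_nat rat) -!coef_seq_pol e.
Qed.

Lemma seq_pol_cat s t : seq_pol (s ++ t) = seq_pol s + seq_pol t.
Proof. by rewrite /seq_pol big_cat. Qed.

Lemma seq_pol_add s k (c : 'I_k -> nat) :
  seq_pol [seq (x + c i)%N | x <- s, i <- enum 'I_k] = seq_pol s * \sum_i 'X^(c i).
Proof.
rewrite /seq_pol big_allpairs_dep /= mulr_suml; apply: eq_bigr => x _.
by rewrite big_enum /= mulr_sumr; apply: eq_bigr => i _; rewrite exprD.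
Qed.

Lemma seq_pol_surj (P : {poly rat}) : (forall k, exists j, P`_k = j%:R) ->
  exists s, seq_pol s = P.
Proof.
move=> /choice[t tP]; exists (flatten [seq nseq (t k) k | k <- iota 0 (size P)]).
rewrite /seq_pol big_flatten big_map /= -[RHS]coefK poly_def -(big_mkord predT (fun k => P`_k *: 'X^k)).
rewrite /index_iota subn0; apply: eq_bigr => k _.
by rewrite tP big_nseq iter_addr_0 scaler_nat.
Qed.

(** After clearing denominators in [rational_exchange], coefficients are read as
    multiplicities. *)
Lemma degree_exchange : exists ts us : seq nat, ts != [::] /\
  perm_eq (ts ++ [seq (u + a i)%N | u <- us, i <- enum 'I_m])
          (us ++ [seq (t + b j)%N | t <- ts, j <- enum 'I_n]).
Proof.
have [T [S [eq T0 T_ge0 S_ge0]]] := rational_exchange.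
have [qT [dT dT0 eT]] := rat_poly_scale T.
have [qS [dS dS0 eS]] := rat_poly_scale S.
pose N : rat := `|dT%:~R * dS%:~R|.
have N0 : N != 0 by rewrite normr_eq0 mulf_neq0// intr_eq0.
have natN (P : {poly rat}) (Q : {poly int}) (d : int) (d' : int) :
    (forall k, 0 <= P`_k) -> d != 0 -> P = d%:~R^-1 *: map_poly (intr : int -> rat) Q ->
    forall k, exists j, (`|d%:~R * d'%:~R : rat| *: P)`_k = j%:R.
  move=> P0 d0 eP k; exists (absz (d' * Q`_k)).
  have -> : (`|d%:~R * d'%:~R : rat| *: P)`_k = `|(d' * Q`_k)%:~R|.
    rewrite coefZ -[P`_k]ger0_norm// -normrM eP coefZ coef_map /=; congr (`|_|).
    by rewrite intrM; field; rewrite intr_eq0.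
  by rewrite -intr_norm -abszE.
have [ts ets] := seq_pol_surj (natN T qT dT dS T_ge0 dT0 eT).
have [us eus] : exists us, seq_pol us = N *: S.
  by rewrite /N mulrC; exact: seq_pol_surj (natN S qS dS dT S_ge0 dS0 eS).
exists ts, us; split.
  apply/eqP => ts0; move: ets; rewrite ts0 /seq_pol big_nil => /esym /eqP.
  by rewrite scaler_eq0 (negbTE T0) orbF -/N (negbTE N0).
apply: seq_pol_inj; rewrite !seq_pol_cat !seq_pol_add ets eus -/N.
rewrite -!scalerAl -!scalerDr; congr (_ *: _).
move: eq; rewrite /char_pol !mulrBr !mulr1 => /eqP.
by rewrite subr_eq addrAC eq_sym subr_eq eq_sym => /eqP.
Qed.

End Exchange.

(** * A transducer between symbolic spaces *)

(** Sorting both types by degree pairs off elements of equal degree. *)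
Lemma fiberwise_bijection (A B : finType) (dA : A -> nat) (dB : B -> nat) (x0 : A) (y0 : B) :
  perm_eq [seq dA x | x <- enum A] [seq dB y | y <- enum B] ->
  exists (phi : A -> B), (forall y, exists x, phi x = y) /\ forall x, dB (phi x) = dA x.
Proof.
move=> peq.
pose sA := sort (relpre dA leq) (enum A); pose sB := sort (relpre dB leq) (enum B).
have e : map dA sA = map dB sB.
  rewrite -!sort_map; apply/perm_sortP => //.
  - by move=> i j; apply: leq_total.
  - by move=> i j k; apply: leq_trans.
  - exact: anti_leq.
have uA : uniq sA by rewrite sort_uniq enum_uniq.
have uB : uniq sB by rewrite sort_uniq enum_uniq.
have mA x : x \in sA by rewrite mem_sort mem_enum.
have mB y : y \in sB by rewrite mem_sort mem_enum.
have sz : size sA = size sB by rewrite -(size_map dA) e size_map.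
exists (fun x => nth y0 sB (index x sA)); split.
- move=> y; exists (nth x0 sA (index y sB)).
  by rewrite index_uniq ?nth_index// sz index_mem.
- move=> x; have ix : (index x sA < size sA)%N by rewrite index_mem.
  by rewrite -(nth_map _ 0%N) -?sz// -e (nth_map x0)// nth_index.
Qed.

Section Transducer.
Variables (m n : nat) (a : 'I_m -> nat) (b : 'I_n -> nat).
Hypothesis a0 : forall i, (0 < a i)%N.
Variables (I J : finType) (dI : I -> nat) (dJ : J -> nat).

(** A state is either a part of the source already assigned to the current
    target cylinder, or a part which has just been cut out of a larger one by
    reading a symbol. *)
Definition state := (I + J * 'I_m)%type.
Definition action := (J + I * 'I_n)%type.

Definition dstate (e : state) : nat :=
  match e with inl t => dI t | inr (u, i) => (dJ u + a i)%N end.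
Definition daction (d : action) : nat :=
  match d with inl u => dJ u | inr (t, j) => (dI t + b j)%N end.

Variable phi : state -> action.
Hypothesis phi_surj : forall d, exists e, phi e = d.
Hypothesis phi_deg : forall e, daction (phi e) = dstate e.
Variables D bm : nat.
Hypothesis hD : forall e, (dstate e <= D)%N.
Hypothesis hb : forall j, (b j <= bm)%N.
Variable j0 : 'I_n.

Fixpoint output (k : nat) (e : state) (x : nat -> 'I_m) : seq 'I_n :=
  if k is k'.+1 then
    match phi e with
    | inr (t, j) => j :: output k' (inl t) x
    | inl u => output k' (inr (u, x 0%N)) (stail x)
    end
  else [::].

(** The degree counts what has been read minus what has been written, so the
    transducer cannot read for long without writing, nor conversely. *)
Lemma size_output k e x :
  (k + dstate e <= size (output k e x) * bm.+1 + D)%N.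
Proof.
elim: k e x => [|k IH] e x /=; first by rewrite mul0n !add0n.
have := phi_deg e; case: (phi e) => [u|[t j]] /= de.
  have := IH (inr (u, x 0%N)) (stail x); rewrite /= de.
  have := a0 (x 0%N); lia.
have := IH (inl t) x; rewrite /= -de.
have := hb j; rewrite mulSn; lia.
Qed.

Lemma output_prefix k k' e x l : (l < size (output k e x))%N -> (k <= k')%N ->
  nth j0 (output k' e x) l = nth j0 (output k e x) l.
Proof.
elim: k k' e x l => [|k IH] [|k'] e x l //=; rewrite ltnS.
case: (phi e) => [u|[t j]] /=; first exact: IH.
by case: l => //= l; rewrite ltnS; apply: IH.
Qed.

(** The length at which the output is read off is large enough for the symbol
    to be written, by [size_output]. *)
Definition transduce (e : state) (x : nat -> 'I_m) : nat -> 'I_n :=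
  fun l => nth j0 (output (l.+1 * bm.+1 + D) e x) l.

Lemma transduceE e x k l : (l < size (output k e x))%N ->
  transduce e x l = nth j0 (output k e x) l.
Proof.
move=> lk; rewrite /transduce; set K := (_ + _)%N.
have lK : (l < size (output K e x))%N.
  have := size_output K e x; rewrite {1}/K => h.
  have : (l.+1 * bm.+1 <= size (output K e x) * bm.+1)%N by lia.
  by rewrite leq_pmul2r.
by case/orP: (leq_total k K) => kK; [|symmetry]; apply: output_prefix.
Qed.

Lemma transduce_long e x l : exists k, (l < size (output k e x))%N.
Proof.
exists (l.+1 * bm.+1 + D)%N; have := size_output (l.+1 * bm.+1 + D) e x => h.
have : (l.+1 * bm.+1 <= size (output (l.+1 * bm.+1 + D) e x) * bm.+1)%N by lia.
by rewrite leq_pmul2r.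
Qed.

Lemma transduce_emit e x t j : phi e = inr (t, j) ->
  transduce e x = scons j (transduce (inl t) x).
Proof.
move=> pe; apply/funext => l; have [k hk] := transduce_long (inl t) x l.
rewrite (@transduceE e x k.+1 l) /= pe /=; last by apply: leq_trans hk _.
case: l hk => //= l hk; symmetry; apply: transduceE; exact: ltnW.
Qed.

Lemma transduce_read e x u : phi e = inl u ->
  transduce e x = transduce (inr (u, x 0%N)) (stail x).
Proof.
move=> pe; apply/funext => l.
have [k hk] := transduce_long (inr (u, x 0%N)) (stail x) l.
by rewrite (@transduceE e x k.+1 l) /= pe /=// (@transduceE _ _ k).
Qed.

(** Going backwards, reading lowers the degree, so that the run has to start at
    an assigned part. *)
Lemma trace_back (d : action) : exists t v e, phi e = d /\
  forall x, transduce (inl t) (wcat v x) = transduce e x.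
Proof.
elim: {d}_.+1 {-2}d (ltnSn (daction d)) => // N IH d; rewrite ltnS => dN.
have [[t|[u i]] pe] := phi_surj d; first by exists t, [::], (inl t).
have := phi_deg (inr (u, i)); rewrite pe /= => de.
have [|t [v [e [pe' h]]]] := IH (inl u).
  by rewrite /=; have := a0 i; lia.
exists t, (rcons v i), (inr (u, i)); split => // x.
by rewrite wcat_rcons h (transduce_read _ pe') /=.
Qed.

(** The run is built from its end, one written symbol at a time. *)
Lemma transduce_prefix N y t' : exists t v, forall x,
  transduce (inl t) (wcat v x) = wcat (mkseq y N) (transduce (inl t') x).
Proof.
elim: N t' => [|N IH] t'; first by exists t', [::].
have [t1 [v1 [e [pe h]]]] := trace_back (inr (t', y N)).
have [t [v hv]] := IH t1; exists t, (v ++ v1) => x.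
by rewrite wcat_cat hv h (transduce_emit _ pe) mkseqS wcat_rcons.
Qed.

Variables (R : realType) (lam : R).
Hypothesis b0 : forall j, (0 < b j)%N.
Hypothesis lam01 : 0 < lam < 1.
Local Notation p := (fun i => lam ^+ a i).
Local Notation q := (fun j => lam ^+ b j).

(** Reading a symbol raises the degree by its exponent and writing one lowers it,
    so that the weights of the prefixes read and written stay comparable. *)
Lemma transduce_agree N k l e x y : (k + l <= N)%N -> agree k x y ->
  lam ^+ dstate e * wt p x k < lam ^+ D * wt q (transduce e x) l ->
  agree l.+1 (transduce e x) (transduce e y).
Proof.
have [l0 l1] := andP lam01.
have q01 j : 0 < lam ^+ b j < 1 by rewrite exprn_gt0//= exprn_ilt1// -?lt0n// ltW.
elim: N k l e x y => [|N IH] k l e x y kl xy.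
  have [-> ->] : k = 0%N /\ l = 0%N by lia.
  rewrite !wt0 !mulr1 ltNge => /negP; case.
  by apply: ler_wiXn2l; rewrite ?ltW.
have := phi_deg e; case pe : (phi e) => [u|[t j]] /= de; last first.
  rewrite !(transduce_emit _ pe) => lt; case: l kl lt => [|l] kl lt; first by move=> [|].
  apply: agree_scons; apply: (IH k) => //; first by lia.
  move: lt; rewrite wtS /= -de exprD -!mulrA [lam ^+ D * _]mulrCA.
  by rewrite [lam ^+ dI t * _]mulrCA ltr_pM2l// exprn_gt0.
case: k kl xy => [|k] kl xy; rewrite !(transduce_read _ pe) => lt.
  exfalso; move: lt; rewrite wt0 mulr1 ltNge => /negP; apply.
  apply: (@le_trans _ _ (lam ^+ D)); last by apply: ler_wiXn2l; rewrite ?ltW.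
  apply: ler_piMr; first by rewrite exprn_ge0// ltW.
  exact: wt_le1.
rewrite -(xy 0%N)//; apply: (IH k); [lia|exact: agree_stail|].
by move: lt; rewrite /= de wtS exprD !mulrA.
Qed.

End Transducer.

Section CommensurableMap.
Variables (R : realType) (m n : nat) (a : 'I_m -> nat) (b : 'I_n -> nat) (lam : R).
Hypothesis a0 : forall i, (0 < a i)%N.
Hypothesis b0 : forall j, (0 < b j)%N.
Hypothesis lam01 : 0 < lam < 1.
Hypothesis suma : \sum_i lam ^+ a i = 1.
Hypothesis sumb : \sum_j lam ^+ b j = 1.
Local Notation p := (fun i => lam ^+ a i).
Local Notation q := (fun j => lam ^+ b j).

Lemma lam_pow01 k (c : 'I_k -> nat) : (forall i, (0 < c i)%N) ->
  forall i, 0 < lam ^+ c i < 1.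
Proof.
have [l0 l1] := andP lam01.
by move=> c0 i; rewrite exprn_gt0//= exprn_ilt1// -?lt0n// ltW.
Qed.

Lemma two_symbols k (c : 'I_k -> nat) : (forall i, (0 < c i)%N) ->
  \sum_i lam ^+ c i = 1 -> exists i i' : 'I_k, i <> i'.
Proof.
case: k c => [|[|k]] c c0; last by move=> _; exists ord0, ord_max => /(congr1 val).
  by rewrite big_ord0 => /esym /eqP; rewrite oner_eq0.
rewrite big_ord1 => e; have := lam_pow01 c0 ord0.
by rewrite e ltxx andbF.
Qed.

(** One map for each initial part; surjectivity of their union follows from
    density by compactness. *)
Lemma lipschitz_family : exists (N : nat) (F : 'I_N.+1 -> (nat -> 'I_m) -> nat -> 'I_n) C,
  1 <= C /\ (forall t, Lip p q C (F t)) /\ forall y, exists t x, F t x = y.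
Proof.
have [l0 l1] := andP lam01.
have [ts [us [ts0 peq]]] := degree_exchange a0 b0 lam01 suma sumb.
have [i0 _] := two_symbols a0 suma; have [j0 _] := two_symbols b0 sumb.
have [N eN] : exists N, size ts = N.+1 by exists (size ts).-1; case: (ts) ts0.
pose dI (t : 'I_N.+1) := nth 0%N ts t.
pose dJ (u : 'I_(size us)) := nth 0%N us u.
have mapI : map dI (enum 'I_N.+1) = ts.
  by rewrite -[RHS](mkseq_nth 0%N) eN /mkseq -val_enum_ord -map_comp.
have mapJ : map dJ (enum 'I_(size us)) = us.
  by rewrite -[RHS](mkseq_nth 0%N) /mkseq -val_enum_ord -map_comp.
have [phi [phi_surj phi_deg]] : exists phi : state m 'I_N.+1 'I_(size us) -> action n 'I_N.+1 'I_(size us),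
   (forall d, exists e, phi e = d) /\
   forall e, daction b dI dJ (phi e) = dstate a dI dJ e.
  apply: (fiberwise_bijection (inl ord0) (inr (ord0, j0))).
  have enumsum (A B : finType) (f : A + B -> nat) : perm_eq [seq f x | x <- enum {: A + B}]
      ([seq f (inl x) | x <- enum A] ++ [seq f (inr x) | x <- enum B]).
    have -> : [seq f (inl x) | x <- enum A] ++ [seq f (inr x) | x <- enum B] =
        map f (map inl (enum A) ++ map inr (enum B)) by rewrite map_cat -!map_comp.
    apply: perm_map; apply: uniq_perm.
    - exact: enum_uniq.
    - have iL : injective (@inl A B) by move=> ? ? [].
      have iR : injective (@inr A B) by move=> ? ? [].
      rewrite cat_uniq (map_inj_uniq iL) (map_inj_uniq iR) !enum_uniq /= andbT.
      by apply/hasPn => _ /mapP[x _ ->]; apply/mapP => -[].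
    - move=> x; rewrite mem_enum mem_cat; case: x => x; symmetry; apply/orP.
        by left; apply: map_f; rewrite mem_enum.
      by right; apply: map_f; rewrite mem_enum.
  have enumprod (A : finType) k (f : A -> 'I_k -> nat) : perm_eq [seq f x.1 x.2 | x <- enum {: A * 'I_k}]
      [seq f x i | x <- enum A, i <- enum 'I_k].
    have -> : [seq f x i | x <- enum A, i <- enum 'I_k] =
        map (fun x => f x.1 x.2) [seq (x, i) | x <- enum A, i <- enum 'I_k].
      by rewrite map_allpairs.
    apply: perm_map; apply: uniq_perm; first exact: enum_uniq.
      by apply: allpairs_uniq; rewrite ?enum_uniq// => -[? ?] [? ?].
    move=> [x i]; rewrite mem_enum; symmetry; apply/allpairsP.
    by exists (x, i); rewrite !mem_enum.
  apply: perm_trans (enumsum _ _ _) _; rewrite perm_sym.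
  apply: perm_trans (enumsum _ _ _) _; rewrite perm_sym /= -/dI -/dJ mapI mapJ.
  have [eqU eqI] : [seq (let (u, i) := x in (dJ u + a i)%N) | x : 'I_(size us) * 'I_m <- enum {: 'I_(size us) * 'I_m}] =
      [seq (dJ x.1 + a x.2)%N | x <- enum {: 'I_(size us) * 'I_m}] /\
     [seq (let (t, j) := x in (dI t + b j)%N) | x : 'I_N.+1 * 'I_n <- enum {: 'I_N.+1 * 'I_n}] =
      [seq (dI x.1 + b x.2)%N | x <- enum {: 'I_N.+1 * 'I_n}].
    by split; apply: eq_map => -[].
  rewrite eqU eqI.
  have pU : perm_eq [seq (dJ x.1 + a x.2)%N | x <- enum {: 'I_(size us) * 'I_m}]
      [seq (u + a i)%N | u <- us, i <- enum 'I_m].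
    by rewrite -[in X in perm_eq _ X]mapJ allpairs_mapl; exact: (enumprod _ m (fun u i => dJ u + a i)%N).
  have pI : perm_eq [seq (dI x.1 + b x.2)%N | x <- enum {: 'I_N.+1 * 'I_n}]
      [seq (t + b j)%N | t <- ts, j <- enum 'I_n].
    by rewrite -[in X in perm_eq _ X]mapI allpairs_mapl; exact: (enumprod _ n (fun t j => dI t + b j)%N).
  apply: (perm_trans (perm_cat (perm_refl ts) pU)); rewrite perm_sym.
  by apply: (perm_trans (perm_cat (perm_refl us) pI)); rewrite perm_sym.
pose D := (\max_e dstate a dI dJ e)%N; pose bm := (\max_j b j)%N.
have hD e : (dstate a dI dJ e <= D)%N by apply: (bigop.leq_bigmax e).
have hb j : (b j <= bm)%N by apply: (bigop.leq_bigmax j).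
pose F t := transduce phi D bm j0 (inl t).
exists N, F, (lam ^- D).
have D0 : 0 < lam ^+ D by rewrite exprn_gt0.
have LF t : Lip p q (lam ^- D) (F t).
  move=> k l x y xy lt; apply: (transduce_agree a0 phi_deg hD hb b0 lam01 (leqnn (k + l)) xy).
  rewrite -/(F t); apply: (@le_lt_trans _ _ (lam ^+ D * (lam ^- D * wt p x k))).
    rewrite mulrA mulfV ?gt_eqF// mul1r; apply: ler_piMl.
      by apply/ltW/wt_gt0/lam_pow01.
    by apply: exprn_ile1; apply: ltW.
  by rewrite ltr_pM2l.
split; first by rewrite invf_ge1// exprn_ile1// ltW.
split => // y; have [U [UU Ufree]] := free_ultrafilter.
have /choice[s sP] : forall k, exists s : 'I_N.+1 * (nat -> 'I_m), agree k (F s.1 s.2) y.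
  move=> k; have [t [v h]] := transduce_prefix a0 phi_surj phi_deg hD hb j0 k y ord0.
  by exists (t, wcat v (fun=> i0)); rewrite /F h; apply: wcat_mkseq.
have [t ht] := ultra_const UU (fun k => (s k).1).
have [x hx] := ultra_seq UU (fun k => (s k).2).
exists t, x; apply: agree_all => k.
have [K hK] := Lip_unif (lam_pow01 a0) (lam_pow01 b0) (lam ^- D) k.
have [k' /= [[e1 e2] e3]] := ultra_ex UU (ultraI UU (ultraI UU ht (hx K)) (Ufree k)).
apply: agree_trans (agreeW e3 (sP k')); rewrite e1; apply: agree_sym.
exact: hK (LF t) e2.
Qed.

(** The initial part is selected by the first symbols of the argument. *)
Lemma lipschitz_surjection_ex : exists (f : (nat -> 'I_m) -> nat -> 'I_n) C,
  Lip p q C f /\ forall y, exists x, f x = y.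
Proof.
have p01 := lam_pow01 a0; have q01 := lam_pow01 b0.
have [N [F [C [C1 [LF sF]]]]] := lipschitz_family.
have [i0 [i1 i01]] := two_symbols a0 suma.
have [plo [phi [/andP[plo0 _] _ pb]]] := ratio_bounds p01.
pose init (x : nat -> 'I_m) : 'I_N.+1 := inord (\sum_(k < N) (x k != i0))%N.
pose tail (x : nat -> 'I_m) k := x (N + k)%N.
have wt_tail x k : wt p x (N + k) = wt p x N * wt p (tail x) k.
  by rewrite /wt big_split_ord.
have L0 : 0 < plo ^+ N by rewrite exprn_gt0.
exists (fun x => F (init x) (tail x)), (C / plo ^+ N); split; last first.
  move=> y; have [t [x e]] := sF y.
  exists (fun k => if (k < N)%N then (if (k < t)%N then i1 else i0) else x (k - N)%N).
  rewrite -e; congr (F _ _).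
    apply/val_inj; rewrite /init /= inordK; last first.
      have eN : (\sum_(k < N) 1)%N = N by rewrite sum1_card card_ord.
      by rewrite ltnS -[X in (_ <= X)%N]eN; apply: leq_sum => k _; apply: leq_b1.
    transitivity (\sum_(k < N | (k < t)%N) 1)%N.
      rewrite [RHS]big_mkcond; apply: eq_bigr => k _; rewrite ltn_ord.
      by case: ltnP => _; rewrite ?eqxx//; case: eqP => // /esym.
    rewrite -(big_mkord (fun k => predT k && (k < t)%N) (fun=> 1%N)).
    rewrite -(big_nat_widen 0 t N predT (fun=> 1%N)); last by rewrite -ltnS.
    by rewrite big_const_nat iter_addn_0 subn0 mul1n.
  by apply/funext => k; rewrite /tail ltnNge leq_addr /= addKn.
move=> k l x y xy lt; have [kN|Nk] := ltnP k N.
  exfalso; move: lt; rewrite ltNge => /negP; apply.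
  apply: (@le_trans _ _ 1); first exact: wt_le1.
  have /andP[wlo _] := wt_bounds p01 x k plo0 pb.
  rewrite mulrAC ler_pdivlMr// mul1r.
  apply: (@le_trans _ _ (plo ^+ k)).
    apply: ler_wiXn2l; [exact: ltW| |exact: ltnW].
    case/andP: (pb i0) => h _; apply: le_trans h _.
    by case/andP: (p01 i0) => _ /ltW.
  by apply: le_trans wlo _; rewrite ler_peMl// ltW// wt_gt0.
have -> : init y = init x.
  by congr inord; apply: eq_bigr => i _; rewrite (xy i)//; apply: leq_trans Nk.
apply: (LF (init x) (k - N)%N) => //.
  by move=> i ik; apply: xy; rewrite -ltn_subRL.
apply: le_lt_trans lt; rewrite -[in leRHS](subnKC Nk) wt_tail.
have /andP[wlo _] := wt_bounds p01 x N plo0 pb.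
set W := wt p (tail x) _.
have -> : C / plo ^+ N * (wt p x N * W) = C * W * (wt p x N / plo ^+ N) by field; rewrite lt0r_neq0.
apply: ler_peMr; last by rewrite ler_pdivlMr// mul1r.
by apply: mulr_ge0; [lra|apply/ltW/wt_gt0].
Qed.

End CommensurableMap.

(** * Coding dust-like sets *)

Section EuclideanDistance.
Variables (R : realType) (d : nat).
Implicit Types x y z : 'rV[R]_d.

Lemma eucl_ge0 x y : 0 <= edist x y. Proof. exact: sqrtr_ge0. Qed.

Lemma euclxx x : edist x x = 0.
Proof. by rewrite /edist big1 ?sqrtr0// => i _; rewrite subrr expr0n. Qed.

Lemma euclC x y : edist x y = edist y x.
Proof. by rewrite /edist; congr Num.sqrt; apply: eq_bigr => i _; rewrite -sqrrN opprB. Qed.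

Lemma coord_le_edist x y i : `|x 0 i - y 0 i| <= edist x y.
Proof.
rewrite -sqrtr_sqr /edist; apply: ler_wsqrtr.
by rewrite (bigD1 i)//= lerDl; apply: sumr_ge0 => j _; apply: sqr_ge0.
Qed.

Lemma edist_le_coord x y e : 0 <= e -> (forall i, `|x 0 i - y 0 i| <= e) ->
  edist x y <= Num.sqrt d%:R * e.
Proof.
move=> e0 h; rewrite -[X in _ * X]ger0_norm// -sqrtr_sqr -sqrtrM ?ler0n//.
apply: ler_wsqrtr; rewrite mulr_natl -[X in _ *+ X]card_ord -sumr_const.
by apply: ler_sum => i _; rewrite -real_normK ?num_real// lerXn2r ?nnegrE.
Qed.

Lemma eucl_eq0 x y : edist x y = 0 -> x = y.
Proof.
move=> e; apply/rowP => i; apply/eqP; rewrite -subr_eq0 -normr_le0 -e.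
exact: coord_le_edist.
Qed.

(** A quasi-triangle inequality, which is enough for all limits below. *)
Lemma edist_quasi_triangle y x z :
  edist x z <= Num.sqrt d%:R * (edist x y + edist y z).
Proof.
apply: edist_le_coord => [|i]; first by rewrite addr_ge0 ?eucl_ge0.
rewrite -(subrKA (y 0 i)) (le_trans (ler_normD _ _))// lerD//; exact: coord_le_edist.
Qed.

Section Limits.
Variable U : set_system nat.
Hypothesis UU : UltraFilter U.

Definition ulim (u : nat -> 'rV[R]_d) x :=
  forall e, 0 < e -> U [set k | edist (u k) x < e].

Lemma ulim_compact (X : set 'rV[R]_d) u : compact X -> (forall k, X (u k)) ->
  exists2 x, X x & ulim u x.
Proof.
move=> cX Xu; have [x Xx h] := ultra_compact UU cX Xu; exists x => // e e0.
have e1 : 0 < e / (Num.sqrt d%:R + 1) by rewrite divr_gt0// ltr_wpDl ?sqrtr_ge0.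
apply: ultraS (h _ (nbhsx_ballx x _ e1)) => k /= hk.
apply: (@le_lt_trans _ _ (Num.sqrt d%:R * (e / (Num.sqrt d%:R + 1)))).
  apply: edist_le_coord => [|i]; first exact: ltW.
  by apply/ltW; rewrite distrC; have := hk.2 0 i; rewrite -ball_normE.
rewrite mulrCA gtr_pMr// ltr_pdivrMr ?mul1r ?ltrDl// ltr_wpDl// sqrtr_ge0.
Qed.

Lemma ulim_scale (e r : R) v y u x : 0 < e -> 0 < r -> ulim u x ->
  (forall k, edist (v k) y <= r * edist (u k) x) -> U [set k | edist (v k) y < e].
Proof.
move=> e0 r0 h hv; have e1 : 0 < e / r by rewrite divr_gt0.
apply: ultraS (h _ e1) => k /= hk; apply: le_lt_trans (hv k) _.
by rewrite mulrC -ltr_pdivlMr.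
Qed.

Lemma ulim_close u v x y : ulim u x -> ulim v y ->
  (forall e, 0 < e -> U [set k | edist (u k) (v k) < e]) -> x = y.
Proof.
move=> ux vy uv; apply: eucl_eq0; apply/eqP; rewrite eq_le eucl_ge0 andbT.
apply/ler_addgt0Pl => e e0; rewrite addr0.
pose c : R := Num.sqrt d%:R + 1.
have c1 : 1 <= c by rewrite lerDr sqrtr_ge0.
have c0 : 0 < c by apply: lt_le_trans c1.
have e1 : 0 < e / (4 * (c * c)) by rewrite divr_gt0// !mulr_gt0.
have [k /= [[h1 h2] h3]] := ultra_ex UU (ultraI UU (ultraI UU (ux _ e1) (vy _ e1)) (uv _ e1)).
set e' := e / _ in e1 h1 h2 h3.
have le_c (z : R) : 0 <= z -> Num.sqrt d%:R * z <= c * z by move=> z0; rewrite ler_wpM2r// lerDl.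
have t1 : edist (u k) y <= c * (e' + e').
  apply: le_trans (edist_quasi_triangle (v k) _ _) _.
  apply: le_trans (le_c _ _) _; first by rewrite addr_ge0 ?eucl_ge0.
  by rewrite ler_pM2l// lerD// ltW.
apply: le_trans (edist_quasi_triangle (u k) _ _) _.
apply: le_trans (le_c _ _) _; first by rewrite addr_ge0 ?eucl_ge0.
apply: (@le_trans _ _ (c * (c * e' + c * (e' + e')))).
  rewrite ler_pM2l// lerD// euclC; apply: le_trans (ltW h1) _.
  by rewrite ler_peMl// ltW.
have eE : e = 4 * (c * c) * e'.
  by rewrite /e' mulrCA divff ?mulr1// gt_eqF// !mulr_gt0.
have pos : 0 < c * c * e' := mulr_gt0 (mulr_gt0 c0 c0) e1.
clearbody e'; rewrite eE.
have -> : c * (c * e' + c * (e' + e')) = 3 * (c * c * e') by ring.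
have -> : 4 * (c * c) * e' = 4 * (c * c * e') by ring.
by rewrite ler_pM2r// ler_nat.
Qed.

End Limits.
End EuclideanDistance.

(** [pt] and [ad] identify [X] with the symbolic space, bi-Lipschitzly when the
    distance of two sequences is the weight of their longest common prefix. *)
Definition coding (R : realType) (d m : nat) (X : set 'rV[R]_d) (r : 'I_m -> R)
    (pt : (nat -> 'I_m) -> 'rV[R]_d) (ad : 'rV[R]_d -> nat -> 'I_m) (D del : R) : Prop :=
  [/\ 0 < D /\ 0 < del,
      forall s, X (pt s) /\ ad (pt s) = s,
      forall x, X x -> pt (ad x) = x,
      forall n s t, agree n s t -> edist (pt s) (pt t) <= D * wt r s n &
      forall n s t, agree n s t -> s n <> t n -> del * wt r s n <= edist (pt s) (pt t)].

Section Coding.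
Variables (R : realType) (d m : nat) (Phi : 'I_m -> 'rV[R]_d -> 'rV[R]_d).
Variables (X : set 'rV[R]_d) (r : 'I_m -> R).
Hypothesis dust : dust_like Phi X.
Hypothesis simr : forall i, contracting_similarity (r i) (Phi i).
Hypothesis X0 : X !=set0.

Let r01 i : 0 < r i < 1. Proof. by case: (simr i). Qed.
Let cX : compact X. Proof. by case: dust => -[]. Qed.

Let Phi_sub i x : X x -> X (Phi i x).
Proof. by case: dust => -[_ _ e] _ Xx; rewrite e; exists i => //; exists x. Qed.

Let Phi_cover x : X x -> exists i y, X y /\ Phi i y = x.
Proof.
by case: dust => -[_ _ e] _; rewrite [X in X x -> _]e => -[i _ [y Xy <-]]; exists i, y.
Qed.

Lemma bounded_set : exists D, 0 < D /\ forall x y, X x -> X y -> edist x y <= D.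
Proof.
apply: contrapT => hn.
have /choice[xy xyP] : forall k, exists xy : 'rV[R]_d * 'rV[R]_d,
    [/\ X xy.1, X xy.2 & k.+1%:R < edist xy.1 xy.2].
  move=> k; apply: contrapT => h; apply: hn; exists k.+1%:R; split => // x y Xx Xy.
  by rewrite leNgt; apply/negP => lt; apply: h; exists (x, y).
have [U [UU Ufree]] := free_ultrafilter.
have [|x Xx hx] := ulim_compact UU (u := fun k => (xy k).1) cX; first by move=> k; case: (xyP k).
have [|y Xy hy] := ulim_compact UU (u := fun k => (xy k).2) cX; first by move=> k; case: (xyP k).
pose c : R := Num.sqrt d%:R; have c0 : 0 <= c := sqrtr_ge0 _.
pose B := c * (1 + c * (edist x y + 1)).
have [k /= [[h1 h2] h3]] := ultra_ex UU (ultraI UU (ultraI UU (hx _ ltr01) (hy _ ltr01))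
  (Ufree (Num.truncn B))).
have [_ _] := xyP k; apply/negP; rewrite -leNgt.
apply: (@le_trans _ _ B); last first.
  by apply: le_trans (ltW (truncnS_gt B)) _; rewrite ler_nat.
apply: le_trans (edist_quasi_triangle x _ _) _; apply: ler_wpM2l => //.
apply: lerD; first exact: ltW.
apply: le_trans (edist_quasi_triangle y _ _) _; apply: ler_wpM2l => //.
by rewrite lerD2l euclC ltW.
Qed.

(** The first-level pieces are compact and disjoint, hence apart. *)
Lemma separated_pieces : exists del, 0 < del /\
  forall i j x y, i <> j -> X x -> X y -> del <= edist (Phi i x) (Phi j y).
Proof.
apply: contrapT => hn.
have /choice[s sP] : forall k, exists s : ('I_m * 'I_m) * ('rV[R]_d * 'rV[R]_d),
    [/\ s.1.1 <> s.1.2, X s.2.1, X s.2.2 &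
        edist (Phi s.1.1 s.2.1) (Phi s.1.2 s.2.2) < k.+1%:R^-1].
  move=> k; apply: contrapT => h; apply: hn; exists k.+1%:R^-1; split => // i j x y ij Xx Xy.
  by rewrite leNgt; apply/negP => lt; apply: h; exists ((i, j), (x, y)).
have [U [UU Ufree]] := free_ultrafilter.
have [[i j] hij] := ultra_const UU (fun k => (s k).1).
have [|x Xx hx] := ulim_compact UU (u := fun k => (s k).2.1) cX; first by move=> k; case: (sP k).
have [|y Xy hy] := ulim_compact UU (u := fun k => (s k).2.2) cX; first by move=> k; case: (sP k).
have ij : i <> j by have [k /= e] := ultra_ex UU hij; have [] := sP k; rewrite e.
have e : Phi i x = Phi j y.
  apply: (ulim_close UU (u := fun k => Phi i (s k).2.1) (v := fun k => Phi j (s k).2.2)).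
  - move=> e e0; apply: (ulim_scale UU (r := r i) e0 _ hx) => [|k]; first by case/andP: (r01 i).
    by rewrite (simr i).2.
  - move=> e e0; apply: (ulim_scale UU (r := r j) e0 _ hy) => [|k]; first by case/andP: (r01 j).
    by rewrite (simr j).2.
  - move=> e e0; apply: ultraS (ultraI UU hij (Ufree (Num.truncn e^-1))) => k /= [ek kk].
    have [_ _ _] := sP k; rewrite ek /= => lt; apply: lt_trans lt _.
    rewrite -[ltRHS]invrK ltf_pV2 ?posrE ?invr_gt0//.
    by apply: lt_le_trans (truncnS_gt _) _; rewrite ler_nat.
case: dust => _ /(_ i j) h; have : (Phi i @` X `&` Phi j @` X) (Phi i x).
  by split; [exists x|exists y].
by rewrite h//; apply/eqP.
Qed.

Fixpoint branch (n : nat) (s : nat -> 'I_m) : 'rV[R]_d -> 'rV[R]_d :=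
  if n is n'.+1 then Phi (s 0%N) \o branch n' (stail s) else id.

Lemma branchSr n s x : branch n.+1 s x = branch n s (Phi (s n) x).
Proof. by elim: n s x => //= n IH s x; rewrite -IH. Qed.

Lemma branch_agree n s t : agree n s t -> branch n s = branch n t.
Proof.
by elim: n s t => //= n IH s t h; rewrite (IH _ (stail t)) ?(h 0%N)//; apply: agree_stail.
Qed.

Lemma branch_edist n s x y : edist (branch n s x) (branch n s y) = wt r s n * edist x y.
Proof.
elim: n s => [|n IH] s /=; first by rewrite wt0 mul1r.
by case: (simr (s 0%N)) => _ ->; rewrite IH wtS mulrA.
Qed.

Lemma branch_sub n s x : X x -> X (branch n s x).
Proof. by move=> Xx; elim: n s => //= n IH s; apply: Phi_sub. Qed.

Lemma address_ex x : X x -> exists s, forall n, (branch n s @` X) x.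
Proof.
move=> Xx; have [i0 _] := Phi_cover Xx.
have /choice[h hP] : forall y, exists iy : 'I_m * 'rV[R]_d,
    X y -> X iy.2 /\ Phi iy.1 iy.2 = y.
  move=> y; have [/Phi_cover[i [z [Xz e]]]|hn] := pselect (X y); first by exists (i, z).
  by exists (i0, y) => /hn.
exists (fun n => (h (iter n (fun y => (h y).2) x)).1).
suff H n : X (iter n (fun y => (h y).2) x) /\
    branch n (fun n => (h (iter n (fun y => (h y).2) x)).1) (iter n (fun y => (h y).2) x) = x.
  by move=> n; exists (iter n (fun y => (h y).2) x); case: (H n).
elim: n => [|n [IH1 IH2]] //; split; first by case: (hP _ IH1).
by rewrite branchSr -[RHS]IH2; congr (branch _ _ _); case: (hP _ IH1).
Qed.

(** The limit of the points obtained by applying longer and longer compositions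
    to a fixed point lies in every cylinder along [s]. *)
Lemma coded_point s : exists x, forall n, (branch n s @` X) x.
Proof.
have [x0 Xx0] := X0; have [U [UU Ufree]] := free_ultrafilter.
have [|z Xz hz] := ulim_compact UU (u := fun k => branch k s x0) cX.
  by move=> k; apply: branch_sub.
exists z => n; pose s' := fun k => s (n + k)%N.
have branchD k x : branch (n + k) s x = branch n s (branch k s' x).
  elim: k x => [|k IH] x; first by rewrite addn0.
  by rewrite addnS !branchSr IH.
have [|w Xw hw] := ulim_compact UU (u := fun k => branch (k - n) s' x0) cX.
  by move=> k; apply: branch_sub.
exists w => //; symmetry.
apply: (ulim_close UU (u := fun k => branch k s x0) (v := fun k => branch n s (branch (k - n) s' x0)) hz).
  move=> e e0; apply: (ulim_scale UU e0 (wt_gt0 r01 s n) hw) => k.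
  by rewrite branch_edist.
move=> e e0; apply: ultraS (Ufree n) => k /= nk.
by rewrite -branchD subnKC// euclxx.
Qed.

Lemma coding_ex : exists pt ad D del, coding X r pt ad D del.
Proof.
have [D [D0 hD]] := bounded_set; have [del [del0 hdel]] := separated_pieces.
have /choice[pt ptP] := coded_point.
have [x0 Xx0] := X0; have [i0 _] := Phi_cover Xx0.
have /choice[ad adP] : forall x, exists s, X x -> forall n, (branch n s @` X) x.
  move=> x; have [/address_ex[s h]|hn] := pselect (X x); first by exists s.
  by exists (fun=> i0) => /hn.
have upper n s t x y : agree n s t -> (branch n s @` X) x -> (branch n t @` X) y ->
    edist x y <= D * wt r s n.
  move=> st [x' Xx' <-] [y' Xy' <-]; rewrite -(branch_agree st) branch_edist mulrC.
  by rewrite ler_pM2r ?wt_gt0// hD.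
have lower n s t x y : agree n s t -> s n <> t n ->
    (branch n.+1 s @` X) x -> (branch n.+1 t @` X) y -> del * wt r s n <= edist x y.
  move=> st ne [x' Xx' <-] [y' Xy' <-]; rewrite !branchSr -(branch_agree st) branch_edist mulrC.
  by rewrite ler_pM2l ?wt_gt0// hdel.
have Xpt s : X (pt s) by have [x Xx <-] := ptP s 0%N.
have uniq_ad s t x : (forall n, (branch n s @` X) x) -> (forall n, (branch n t @` X) x) -> s = t.
  move=> hs ht; apply: contrapT => /first_difference [n [st ne]].
  have := lower n s t x x st ne (hs _) (ht _); rewrite euclxx leNgt => /negP; apply.
  by rewrite mulr_gt0// wt_gt0.
have [lo [hi [/andP[lo0 _] hi01 rb]]] := ratio_bounds r01.
exists pt, ad, D, del; split => //.
- move=> s; split => //; apply: (uniq_ad _ _ (pt s)) => //; exact: adP.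
- move=> x Xx; apply: eucl_eq0; apply/eqP; rewrite eq_le eucl_ge0 andbT.
  apply/ler_addgt0Pl => e e0; rewrite addr0.
  have e1 : 0 < e / D by rewrite divr_gt0.
  have [n hn] := expr_lt_eps hi01 e1.
  have := upper n (ad x) (ad x) _ _ (@agree_refl _ n (ad x)) (ptP (ad x) n) (adP x Xx n).
  move=> h; apply: le_trans h _.
  rewrite mulrC -ler_pdivlMr//; apply: le_trans (ltW hn).
  by case/andP: (wt_bounds r01 (ad x) n lo0 rb).
- by move=> n s t st; apply: upper st _ _.
- by move=> n s t st ne; apply: lower st ne _ _.
Qed.

End Coding.

(** * The dimension of a dust-like set *)

Section CoverWeight.
Variables (R : realType) (m : nat) (p : 'I_m -> R).
Hypothesis p01 : forall i, 0 < p i < 1.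
Hypothesis sp : 1 <= \sum_i p i.

Definition starts (s : nat -> 'I_m) (w : seq 'I_m) : bool := mkseq s (size w) == w.

Lemma starts_cons i s w : starts (scons i s) (i :: w) = starts s w.
Proof.
by rewrite /starts mkseq_stail eqseq_cons eqxx.
Qed.

Lemma starts_head s i w : starts s (i :: w) -> s 0%N = i.
Proof. by rewrite /starts mkseq_stail eqseq_cons => /andP[/eqP]. Qed.

Lemma symbol_ex : exists i : 'I_m, true.
Proof.
case: (m) p sp => [p0 |k *]; last by exists ord0.
by rewrite big_ord0 ler10.
Qed.

(** By induction on the length of the longest word, splitting the cover according
    to first letters. *)
Lemma finite_cover_weight (L : seq (seq 'I_m)) :
  (forall s, exists2 w, w \in L & starts s w) -> 1 <= \sum_(w <- L) wordwt p w.
Proof.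
have [N] : exists N, all (fun w => size w <= N)%N L.
  exists (\max_(w <- L) size w)%N; apply/allP => w wL.
  by rewrite (big_rem w)//= leq_maxl.
elim: N L => [|N IH] L /allP sz cov.
  have [i0 _] := symbol_ex; have [w wL _] := cov (fun=> i0).
  have w0 : w = [::] by apply: size0nil; apply/eqP; rewrite -leqn0 sz.
  rewrite (big_rem w)//= {1}w0 {1}/wordwt big_nil lerDl; apply: sumr_ge0 => v _.
  exact/ltW/wordwt_gt0.
have [nL|nL] := boolP ([::] \in L).
  rewrite (big_rem [::])//= {1}/wordwt big_nil lerDl; apply: sumr_ge0 => v _.
  exact/ltW/wordwt_gt0.
pose Li i := [seq behead w | w <- L & ohead w == Some i].
have -> : \sum_(w <- L) wordwt p w = \sum_i p i * \sum_(w <- Li i) wordwt p w.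
  transitivity (\sum_(w <- L) \sum_(i | ohead w == Some i) p i * wordwt p (behead w)).
    rewrite !big_seq; apply: eq_bigr => -[|j w] wL; first by rewrite wL in nL.
    rewrite (big_pred1 j) /=; first by rewrite /wordwt big_cons.
    by move=> i /=; rewrite eq_sym; apply/eqP/eqP => [[]|->].
  rewrite (exchange_big_dep predT)//=; apply: eq_bigr => i _.
  by rewrite big_map big_filter mulr_sumr.
apply: le_trans sp _; apply: ler_sum => i _; rewrite ler_peMr//.
  by case/andP: (p01 i) => /ltW.
apply: IH.
  apply/allP => v /mapP[w]; rewrite mem_filter => /andP[_ wL] ->.
  by rewrite size_behead; have := sz w wL; lia.
move=> s; have [[|j w] wL] := cov (scons i s); first by rewrite wL in nL.
move=> st; have e := starts_head st; rewrite /= in e; rewrite -e starts_cons in st.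
exists w => //; apply/mapP; exists (j :: w) => //.
by rewrite mem_filter wL /= -e eqxx.
Qed.

Lemma wordwt_mkseq s n : wordwt p (mkseq s n) = wt p s n.
Proof. by rewrite /wordwt big_map -{1}(subn0 n) -/(index_iota 0 n) big_mkord. Qed.

Lemma starts_mkseq s t n : starts s (mkseq t n) <-> agree n s t.
Proof.
rewrite /starts size_mkseq; split => [/eqP e k kn|h].
  by have := congr1 (fun u => nth (s k) u k) e; rewrite !nth_mkseq.
apply/eqP/eq_in_map => k; rewrite mem_iota => /andP[_ kn]; exact: h.
Qed.

(** Countably many cylinders reduce to finitely many by compactness. *)
Lemma countable_cover_weight (s : nat -> nat -> 'I_m) (n : nat -> nat) :
  (forall x, exists k, agree (n k) x (s k)) ->
  exists K, 1 <= \sum_(k < K) wt p (s k) (n k).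
Proof.
move=> cov; suff [K hK] : exists K, forall x, exists2 k, (k < K)%N & agree (n k) x (s k).
  exists K; rewrite -(big_mkord predT (fun k => wt p (s k) (n k))).
  under eq_bigr do rewrite -wordwt_mkseq.
  rewrite -(big_map (fun k => mkseq (s k) (n k)) predT (fun w => wordwt p w)).
  apply: finite_cover_weight => x; have [k kK h] := hK x.
  exists (mkseq (s k) (n k)); last exact/starts_mkseq.
  by apply/mapP; exists k => //; rewrite mem_index_iota.
apply: contrapT => hn.
have /choice[x xP] : forall K, exists x, forall k, (k < K)%N -> ~ agree (n k) x (s k).
  move=> K; apply: contrapT => h; apply: hn; exists K => x; apply: contrapT => hx.
  by apply: h; exists x => k kK ag; apply: hx; exists k.
have [U [UU Ufree]] := free_ultrafilter.
have [z hz] := ultra_seq UU x; have [k hk] := cov z.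
have [K /= [h1 h2]] := ultra_ex UU (ultraI UU (hz (n k)) (Ufree k.+1)).
by apply: (xP K k h2); apply: agree_trans h1 hk.
Qed.

Fixpoint words (N : nat) : seq (seq 'I_m) :=
  if N is N'.+1 then [seq i :: w | i <- enum 'I_m, w <- words N'] else [:: [::]].

Lemma words_weight N : \sum_(w <- words N) wordwt p w = (\sum_i p i) ^+ N.
Proof.
elim: N => [|N IH] /=; first by rewrite big_seq1 /wordwt big_nil expr0.
rewrite big_allpairs_dep /= big_enum /= exprS mulr_suml; apply: eq_bigr => i _.
by rewrite -IH mulr_sumr; apply: eq_bigr => w _; rewrite /wordwt big_cons.
Qed.

Lemma mem_words N s : mkseq s N \in words N.
Proof.
elim: N s => [|N IH] s //; rewrite mkseq_stail.
apply/allpairsPdep; exists (s 0%N), (mkseq (stail s) N); rewrite mem_enum.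
by split.
Qed.

Lemma size_words N w : w \in words N -> size w = N.
Proof.
elim: N w => [|N IH] w /=; first by rewrite inE => /eqP ->.
by move=> /allpairsPdep[i [v [_ /IH <- ->]]].
Qed.

End CoverWeight.

Lemma wt_powR (R : realType) m (r : 'I_m -> R) t s n : (forall i, 0 < r i < 1) ->
  wt (fun i => r i `^ t) s n = wt r s n `^ t.
Proof.
move=> r01; elim: n => [|n IH]; first by rewrite !wt0 powR1.
rewrite !wtSr IH powRM//; first exact/ltW/wt_gt0.
by case/andP: (r01 (s n)) => /ltW.
Qed.

Lemma powR01 (R : realType) (x t : R) : 0 < x < 1 -> 0 < t -> 0 < x `^ t < 1.
Proof.
move=> /andP[x0 x1] t0; rewrite powR_gt0//=.
have := gt0_ltr_powR t0 (_ : x \in Num.nneg) (_ : 1 \in Num.nneg) x1.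
by rewrite powR1 !nnegrE; apply; rewrite ?ler01// ltW.
Qed.

Section Dimension.
Variables (R : realType) (d m : nat) (X : set 'rV[R]_d) (r : 'I_m -> R).
Hypothesis r01 : forall i, 0 < r i < 1.
Variables (pt : (nat -> 'I_m) -> 'rV[R]_d) (ad : 'rV[R]_d -> nat -> 'I_m) (D del : R).
Variable i0 : 'I_m.
Hypothesis cod : coding X r pt ad D del.

Let D0 : 0 < D. Proof. by case: cod => -[]. Qed.
Let del0 : 0 < del. Proof. by case: cod => -[]. Qed.
Let ptX s : X (pt s) /\ ad (pt s) = s. Proof. by case: cod => _ + _ _ _; apply. Qed.
Let adK x : X x -> pt (ad x) = x. Proof. by case: cod => _ _ + _ _; apply. Qed.
Let upper n s t : agree n s t -> edist (pt s) (pt t) <= D * wt r s n.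
Proof. by case: cod => _ _ _ + _; apply. Qed.
Let lower n s t : agree n s t -> s n <> t n ->
  del * wt r s n <= edist (pt s) (pt t).
Proof. by case: cod => _ _ _ _; apply. Qed.

Lemma diam_pow_ge0 t (U : set 'rV[R]_d) : (0 <= diam_pow t U)%E.
Proof. by rewrite /diam_pow; case: ifP => // _; apply: poweR_ge0. Qed.

(** Points whose codes separate at level [k] are at distance at least
    [del * wt k], so all codes of points of [U] agree up to the first level where
    this bound drops below the diameter. *)
Lemma cylinder_of_set t (U : set 'rV[R]_d) c eta : 0 < t -> 0 < eta ->
  diam_pow t U = c%:E -> exists s n, (forall x, X x -> U x -> agree n (ad x) s) /\
    wt r s n `^ t <= del `^ (- t) * c + eta.
Proof.
move=> t0 eta0 dc.
have [lo [hi [/andP[lo0 _] hi01 rb]]] := ratio_bounds r01.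
have dt0 : 0 < del `^ t by rewrite powR_gt0.
have dtV : del `^ (- t) = (del `^ t)^-1 by rewrite powRN.
have c0 : 0 <= c by rewrite -lee_fin -dc diam_pow_ge0.
have tV0 : 0 < t^-1 by rewrite invr_gt0.
have wle s e : 0 < e -> exists n, del * wt r s n <= e.
  move=> e0; have e1 : 0 < e / del by rewrite divr_gt0.
  have [n hn] := expr_lt_eps hi01 e1; exists n.
  rewrite mulrC -ler_pdivlMr//; apply: le_trans (ltW hn).
  by case/andP: (wt_bounds r01 s n lo0 rb).
have conv s n e : 0 <= e -> del * wt r s n <= e -> wt r s n `^ t <= del `^ (- t) * e `^ t.
  move=> e0 h; rewrite dtV -ler_pdivrMl ?invr_gt0// invrK -powRM ?(ltW del0) ?(ltW (wt_gt0 r01 s n))//.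
  by rewrite ge0_ler_powR// ?nnegrE ?(ltW t0)// mulr_ge0// ltW// wt_gt0.
have E0 : 0 < (eta * del `^ t) `^ t^-1 by rewrite powR_gt0// mulr_gt0.
have EP : ((eta * del `^ t) `^ t^-1) `^ t = eta * del `^ t.
  by rewrite -powRrM mulVf ?gt_eqF// powRr1// mulr_ge0// ltW.
have [[x [Xx Ux]]|hn] := pselect (exists x, X x /\ U x); last first.
  pose s : nat -> 'I_m := fun=> i0.
  have [n hn'] := wle s _ E0; exists s, n; split.
    by move=> x Xx Ux; case: hn; exists x.
  apply: le_trans (conv _ _ _ (ltW E0) hn') _.
  by rewrite EP dtV mulrCA mulVf ?mulr1 ?gt_eqF// lerDr mulr_ge0// invr_ge0 ltW.
have U0 : U != set0 by apply/set0P; exists x.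
have diamP y : U y -> ((edist x y)%:E <= diameter U)%E.
  by move=> Uy; apply: ereal_sup_ubound; exists x, y.
have [dm [dm0 ec hdm]] : exists dm, [/\ 0 <= dm, c = dm `^ t & forall y, U y -> edist x y <= dm].
  move: dc diamP; rewrite /diam_pow (negbTE U0); case: (diameter U) => [dm| |] /=.
  - move=> dcE h; exists dm; split; [|by case: dcE|].
      by have := h x Ux; rewrite euclxx lee_fin.
    by move=> y /h; rewrite lee_fin.
  - by rewrite gt_eqF.
  - by move=> _ /(_ x Ux); rewrite leeNy_eq.
(* A positive radius close enough to the diameter, which may vanish. *)
have [e [e0 dme ee]] : exists e, [/\ 0 < e, dm <= e & e `^ t <= c + eta * del `^ t].
  have [dmp|dmn] := ltP 0 dm.
    by exists dm; split => //; rewrite ec lerDl mulr_ge0// ltW.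
  exists ((eta * del `^ t) `^ t^-1); split => //; first by apply: le_trans dmn (ltW E0).
  by rewrite EP lerDr.
pose P n := `[< del * wt r (ad x) n <= e >].
have exP : exists n, P n by have [n hn] := wle (ad x) e e0; exists n; apply/asboolP.
have [n /asboolP Pn minP] := ex_minnP exP.
exists (ad x), n; split.
  move=> y Xy Uy; apply: agree_sym; apply: contrapT.
  move=> /first_disagreement[k [kn ag ne]]; have := lower ag ne; rewrite !adK// => h.
  have : P k by apply/asboolP; apply: le_trans h _; apply: le_trans (hdm y Uy) dme.
  by move=> /minP; rewrite leqNgt kn.
apply: le_trans (conv _ _ _ (ltW e0) Pn) _.
apply: (@le_trans _ _ (del `^ (- t) * (c + eta * del `^ t))).
  by rewrite ler_pM2l// powR_gt0.
by rewrite mulrDr dtV [_^-1 * (eta * _)]mulrCA mulVf ?mulr1// gt_eqF.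
Qed.

Let p t i := r i `^ t.

Let p01 t : 0 < t -> forall i, 0 < p t i < 1.
Proof. by move=> t0 i; apply: powR01. Qed.

Let nneg_premeasure t e A : (0 <= hausdorff_premeasure t e (A : set 'rV[R]_d))%E.
Proof.
by apply: le_ereal_inf_tmp => _ [U _ <-]; apply: nneseries_ge0 => k _ _; apply: diam_pow_ge0.
Qed.

Lemma hausdorff_measure_ge0 t A : (0 <= hausdorff_measure t (A : set 'rV[R]_d))%E.
Proof.
apply: le_trans (nneg_premeasure t 1 A) _.
by apply: ereal_sup_ubound; exists 1 => //=.
Qed.

(** A cover by sets of diameter at most 1 whose [t]-th powers add up to little
    would yield cylinders of total weight smaller than 1. *)
Lemma hausdorff_measure_neq0 t : 0 < t -> 1 <= \sum_i r i `^ t ->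
  hausdorff_measure t X <> 0%E.
Proof.
move=> t0 sr h0.
have dt0 : 0 < del `^ t by rewrite powR_gt0.
have hpm : (hausdorff_premeasure t 1 X <= hausdorff_measure t X)%E.
  by apply: ereal_sup_ubound; exists 1 => //=.
have : (hausdorff_premeasure t 1 X < (del `^ t / 2)%:E)%E.
  apply: (@le_lt_trans _ _ 0%E); last by rewrite lte_fin divr_gt0.
  by rewrite -[X in (_ <= X)%E]h0.
move=> /ereal_inf_lt[_ [U [covU _] <-]] lt.
have fin k : exists c, diam_pow t (U k) = c%:E.
  have : (diam_pow t (U k) < +oo)%E.
    apply: le_lt_trans (lt_trans lt (ltry _)).
    apply: le_trans (nneseries_lim_ge k.+1 (fun _ _ _ => diam_pow_ge0 t _)).
    rewrite big_nat_recr//= -[leLHS]add0e leeD2r//; apply: sume_ge0 => i _; exact: diam_pow_ge0.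
  have := diam_pow_ge0 t (U k); case: (diam_pow t (U k)) => [c| |] // _ _.
  by exists c.
have /choice[c hc] := fin.
(* Errors summing to less than one half, for the sets of diameter 0. *)
pose eta k : R := (2^-1) ^+ k.+2.
have eta0 k : 0 < eta k by rewrite exprn_gt0.
have /choice[sn snP] : forall k, exists sn : (nat -> 'I_m) * nat,
    (forall x, X x -> U k x -> agree sn.2 (ad x) sn.1) /\
    wt r sn.1 sn.2 `^ t <= del `^ (- t) * c k + eta k.
  move=> k; have [s [n [h1 h2]]] := cylinder_of_set t0 (eta0 k) (hc k).
  by exists (s, n).
have [K hK] : exists K, 1 <= \sum_(k < K) wt (p t) (sn k).1 (sn k).2.
  apply: (@countable_cover_weight R m (p t) (p01 t0) sr (fun k => (sn k).1) (fun k => (sn k).2)) => x.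
  have [k _ Uk] := covU _ (ptX x).1; exists k.
  by have := (snP k).1 _ (ptX x).1 Uk; rewrite (ptX x).2.
have sum_eta : \sum_(k < K) eta k <= 2^-1.
  have -> : \sum_(k < K) eta k = 2^-1 - (2^-1) ^+ K.+1.
    elim: (K) => [|k IH]; first by rewrite big_ord0 expr1 subrr.
    rewrite big_ord_recr /= IH /eta !exprS; set z := _ ^+ k; lra.
  by rewrite gerBl exprn_ge0.
have sc : \sum_(k < K) c k < del `^ t / 2.
  rewrite -lte_fin; apply: le_lt_trans lt.
  apply: le_trans (nneseries_lim_ge K (fun _ _ _ => diam_pow_ge0 t _)).
  by rewrite big_mkord -sumEFin; apply: lee_sum => k _; rewrite hc.
have : 1 <= del `^ (- t) * (\sum_(k < K) c k) + \sum_(k < K) eta k.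
  rewrite mulr_sumr -big_split; apply: le_trans hK _; apply: ler_sum => k _ /=.
  by rewrite wt_powR//; exact: (snP k).2.
rewrite powRN; apply/negP; rewrite -ltNge.
have : (del `^ t)^-1 * \sum_(k < K) c k < 2^-1.
  by rewrite ltr_pdivrMl.
lra.
Qed.

Lemma hausdorff_measure_eq0 t (A : set 'rV[R]_d) :
  (forall e eta, 0 < e -> 0 < eta -> exists U : (set 'rV[R]_d)^nat,
    [/\ A `<=` \bigcup_k U k, forall k, (diameter (U k) <= e%:E)%E &
        (\sum_(k <oo) diam_pow t (U k) <= eta%:E)%E]) ->
  hausdorff_measure t A = 0%E.
Proof.
move=> h; apply/eqP; rewrite eq_le hausdorff_measure_ge0 andbT.
apply: ge_ereal_sup => _ [e /= e0 <-].
apply/lee_addgt0Pr => eta eta0; rewrite add0e.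
have [U [h1 h2 h3]] := h e eta e0 eta0.
by apply: ge_ereal_inf; exists (\sum_(k <oo) diam_pow t (U k))%E => //; exists U.
Qed.

Lemma nth_sum_le (s : seq R) K : (forall x, x \in s -> 0 <= x) ->
  \sum_(k < K) s`_k <= \sum_(x <- s) x.
Proof.
elim: s K => [|x s IH] K h.
  by rewrite big_nil big1// => k _; rewrite nth_nil.
case: K => [|K]; first by rewrite big_ord0 big_seq; apply: sumr_ge0.
rewrite big_ord_recl big_cons lerD2l; apply: IH => y ys; apply: h.
by rewrite inE ys orbT.
Qed.

(** The cylinders of a fixed length are an efficient cover when the ratios
    raised to the power [t] have sum less than 1. *)
Lemma hausdorff_measure_self_similar_eq0 t : 0 < t -> \sum_i r i `^ t < 1 ->
  hausdorff_measure t X = 0%E.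
Proof.
move=> t0 sr; apply: hausdorff_measure_eq0 => e eta e0 eta0.
have [lo [hi [/andP[lo0 _] hi01 rb]]] := ratio_bounds r01.
have sp0 : 0 < \sum_i r i `^ t.
  rewrite (bigD1 i0)//= ltr_wpDr ?powR_gt0//; last by case/andP: (r01 i0).
  by apply: sumr_ge0 => i _; apply: powR_ge0.
have sp01 : 0 < \sum_i r i `^ t < 1 by rewrite sp0 sr.
have Dt0 : 0 < D `^ t by rewrite powR_gt0.
have e1 : 0 < e / D by rewrite divr_gt0.
have eta1 : 0 < eta / D `^ t by rewrite divr_gt0.
have [N1 hN1] := expr_lt_eps hi01 e1; have [N2 hN2] := expr_lt_eps sp01 eta1.
pose N := (N1 + N2)%N; pose ws := words m N.
have hiN : hi ^+ N * D <= e.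
  have [h0 h1] := andP hi01.
  rewrite -ler_pdivlMr//; apply: le_trans (ltW hN1); apply: ler_wiXn2l; rewrite ?ltW//.
  exact: leq_addr.
have spN : D `^ t * (\sum_i r i `^ t) ^+ N <= eta.
  rewrite mulrC -ler_pdivlMr//; apply: le_trans (ltW hN2); apply: ler_wiXn2l; rewrite ?ltW//.
  exact: leq_addl.
pose cyl w : set 'rV[R]_d := [set pt s | s in [set s | starts s w]].
pose U k := if (k < size ws)%N then cyl (nth [::] ws k) else set0.
have diamU w : w \in ws -> (diameter (cyl w) <= (D * wordwt r w)%:E)%E.
  move=> wN; apply: ge_ereal_sup => _ [_ [_ [[s sw <-] [s' sw' <-] ->]]].
  rewrite lee_fin; have ew : w = mkseq s (size w) by apply/esym/eqP.
  have /starts_mkseq ag : starts s' (mkseq s (size w)) by rewrite -ew.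
  by rewrite ew wordwt_mkseq; apply: upper; apply: agree_sym.
have wle w : w \in ws -> wordwt r w <= hi ^+ N.
  move=> wN; rewrite -(size_words wN).
  have -> : wordwt r w = wt r (nth i0 w) (size w).
    by rewrite /wordwt (big_nth i0) big_mkord.
  by case/andP: (wt_bounds r01 (nth i0 w) (size w) lo0 rb).
exists U; split.
- move=> x Xx; have wN := mem_words N (ad x).
  exists (index (mkseq (ad x) N) ws) => //; rewrite /U index_mem wN nth_index//.
  exists (ad x); last exact: adK.
  exact/starts_mkseq.
- move=> k; rewrite /U; case: ltnP => kN; last first.
    by apply: ge_ereal_sup => _ [_ [_ [[]]]].
  have wN : nth [::] ws k \in ws by apply: mem_nth.
  apply: le_trans (diamU _ wN) _; rewrite lee_fin mulrC.
  by apply: le_trans hiN; rewrite ler_pM2r// wle.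
- apply: lime_le; first by apply: is_cvg_nneseries => k _ _; apply: diam_pow_ge0.
  apply: nearW => K.
  pose vs := [seq D `^ t * wordwt (p t) w | w <- ws].
  apply: (@le_trans _ _ (\sum_(k < K) (vs`_k)%:E)%E); last first.
    rewrite sumEFin lee_fin; apply: le_trans (nth_sum_le _ _) _.
      move=> _ /mapP[w _ ->]; rewrite mulr_ge0// ltW// wordwt_gt0//.
      exact: p01.
    by rewrite big_map -mulr_sumr words_weight.
  rewrite big_mkord; apply: lee_sum => k _; rewrite /U; case: ltnP => kN; last first.
    by rewrite nth_default ?size_map// /diam_pow eqxx.
  have wN : nth [::] ws k \in ws by apply: mem_nth.
  rewrite (nth_map [::])//; set w := nth _ _ _ in wN *.
  rewrite /diam_pow; case: eqP => [_|/eqP/set0P[x Ux]].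
    by rewrite lee_fin mulr_ge0// ltW// wordwt_gt0//; exact: p01.
  have dge0 : (0 <= diameter (cyl w))%E.
    apply: le_trans (_ : ((edist x x)%:E <= _)%E); first by rewrite euclxx.
    by apply: ereal_sup_ubound; exists x, x.
  apply: le_trans (_ : (poweR (D * wordwt r w)%:E t <= _)%E).
    apply: gt0_ler_poweR; rewrite ?in_itv/= ?leey ?andbT//; first exact: ltW.
      by rewrite lee_fin mulr_ge0 ?ltW// wordwt_gt0.
    exact: diamU.
  rewrite poweR_EFin lee_fin powRM ?(ltW D0)//; last exact/ltW/wordwt_gt0.
  rewrite ler_pM2l//.
  suff -> : wordwt r w `^ t = wordwt (p t) w by [].
  rewrite /wordwt; elim: (w) => [|i u IH]; first by rewrite !big_nil powR1.
  rewrite !big_cons powRM ?IH//; first by case/andP: (r01 i) => /ltW.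
  exact/ltW/wordwt_gt0.
Qed.

Lemma ratio_sum_powR_anti t u : t <= u -> \sum_i r i `^ u <= \sum_i r i `^ t.
Proof.
move=> tu; apply: ler_sum => i _; apply: ger_powR => //.
by case/andP: (r01 i) => -> /ltW ->.
Qed.

(** Raising the exponent by [h] multiplies the sum by at least [lo ^ h], which is
    close to 1 when [h] is small; so a sum different from 1 at [s] would leave
    room for moving the dimension. *)
Lemma moran_equation s : 0 < s -> hausdorff_dim X = s%:E -> \sum_i r i `^ s = 1.
Proof.
move=> s0 dimX.
have inf_le t : 0 <= t -> hausdorff_measure t X = 0%E -> s <= t.
  move=> t0 ht; rewrite -lee_fin -dimX; apply: ge_ereal_inf.
  by exists t%:E => //; exists t.
have [lo [hi [/andP[lo0 lo1] _ rb]]] := ratio_bounds r01.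
have lnlo : ln lo < 0 by rewrite ln_lt0// lo0 lo1.
have shift_le t h : 0 <= h -> lo `^ h * \sum_i r i `^ t <= \sum_i r i `^ (t + h).
  move=> h0; rewrite mulr_sumr; apply: ler_sum => i _.
  have /andP[r0 _] := r01 i; have /andP[rlo _] := rb i.
  rewrite powRD; last by rewrite (gt_eqF r0) implybT.
  rewrite mulrC ler_pM2l ?powR_gt0//; apply: ge0_ler_powR => //; rewrite nnegrE ltW//.
set F := \sum_i r i `^ s.
have F0 : 0 < F.
  rewrite /F (bigD1 i0)//= ltr_wpDr ?powR_gt0//; last by case/andP: (r01 i0).
  by apply: sumr_ge0 => i _; apply: powR_ge0.
case: (ltgtP F 1) => // hF; exfalso.
- have lnF : ln F < 0 by rewrite ln_lt0// F0 hF.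
  pose h := Num.min (s / 2) (ln F / (2 * ln lo)).
  have h0 : 0 < h.
    rewrite lt_min divr_gt0//= -mulrNN -invrN divr_gt0// oppr_gt0//.
    by rewrite pmulr_rlt0.
  have hs : h <= s / 2 by rewrite ge_min lexx.
  have t0 : 0 < s - h by lra.
  have hh : F / lo `^ h < 1.
    rewrite ltr_pdivrMr ?powR_gt0// mul1r /powR gt_eqF// -[ltLHS]lnK ?posrE//.
    rewrite ltr_expR.
    have : h <= ln F / (2 * ln lo) by rewrite ge_min lexx orbT.
    rewrite invfM mulrA ler_ndivlMr// => h1.
    by apply: lt_le_trans h1; lra.
  have := inf_le (s - h) (ltW t0); rewrite hausdorff_measure_self_similar_eq0//.
    by move=> /(_ erefl); lra.
  apply: le_lt_trans hh; rewrite ler_pdivlMr ?powR_gt0// mulrC.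
  by have := shift_le (s - h) h (ltW h0); rewrite subrK.
- have lnF : 0 < ln F by rewrite ln_gt0.
  pose h := - ln F / ln lo.
  have h0 : 0 < h by rewrite /h -mulrNN opprK -invrN divr_gt0// oppr_gt0.
  have loh : lo `^ h = F^-1.
    rewrite /powR gt_eqF// /h divfK ?lt_eqF// expRN lnK//.
  have F1 : 1 <= \sum_i r i `^ (s + h).
    by apply: le_trans (shift_le s h (ltW h0)); rewrite loh mulVf// gt_eqF.
  have : (s%:E < (s + h)%:E)%E by rewrite lte_fin ltrDl.
  rewrite -dimX => /ereal_inf_lt[_ [u [u0 hu] <-]]; rewrite lte_fin => us.
  have su := inf_le u u0 hu.
  apply: (hausdorff_measure_neq0 (lt_le_trans s0 su) _ hu).
  by apply: le_trans F1 _; apply: ratio_sum_powR_anti; exact: ltW.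
Qed.

End Dimension.

Lemma hausdorff_dim_set0 (R : realType) d : hausdorff_dim (set0 : set 'rV[R]_d) = 0%E.
Proof.
apply/eqP; rewrite eq_le; apply/andP; split; last first.
  by apply: le_ereal_inf_tmp => _ [t [t0 _] <-]; rewrite lee_fin.
apply: ge_ereal_inf; exists 0%E => //; exists 0 => //; split => //.
apply: hausdorff_measure_eq0 => e eta e0 eta0; exists (fun=> set0); split => //.
- by move=> k; apply: ge_ereal_sup => _ [_ [_ [[]]]].
- rewrite eseries0 ?lee_fin ?ltW// => k _ _.
  by rewrite /diam_pow eqxx.
Qed.

(** * Commensurability *)

(** All logarithms are rational multiples of one of them; the base comes from a
    common denominator. *)
Lemma common_base (R : realType) (I : finType) (x : I -> R) :
  (forall i, 0 < x i < 1) ->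
  (forall i j, exists c : rat, ln (x i) / ln (x j) = ratr c) ->
  exists (lam : R) (e : I -> nat),
    [/\ 0 < lam < 1, forall i, (0 < e i)%N & forall i, x i = lam ^+ e i].
Proof.
move=> x01 com.
have [[i0 _]|hn] := pselect (exists i : I, True); last first.
  exists 2^-1, (fun=> 0%N); split; [|by move=> i; case: hn; exists i..].
  by apply/andP; split; lra.
have lnx i : ln (x i) < 0 by apply: ln_lt0.
have /choice[c hc] : forall i, exists c, ln (x i) / ln (x i0) = ratr c by move=> i; apply: com.
have c0 i : 0 < c i.
  by rewrite -(ltr0q R) -hc -mulrNN -invrN divr_gt0// oppr_gt0.
pose N := \prod_i denq (c i).
have N0 : 0 < N by apply: prodr_gt0 => i _; apply: denq_gt0.
have natc i : exists e : nat, N%:~R * c i = e%:R :> rat.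
  exists (absz (numq (c i) * \prod_(j | j != i) denq (c j))).
  have num0 : 0 < numq (c i) by rewrite numq_gt0.
  have pr0 : 0 < \prod_(j | j != i) denq (c j) by apply: prodr_gt0 => j _; apply: denq_gt0.
  rewrite -[X in _ * X]divq_num_den /N (bigD1 i)//= intrM.
  rewrite [_ * (_ / _)]mulrC mulrA divfK ?intr_eq0 ?denq_eq0// -intrM.
  by rewrite -[RHS]/((absz _)%:~R) gez0_abs// ltW// mulr_gt0.
have /choice[e he] := natc.
have NR : 0 < (N%:~R : R) by rewrite ltr0z.
have cE i : ratr (c i) = (e i)%:R / N%:~R :> R.
  have -> : c i = (e i)%:R / N%:~R by rewrite -he mulrC mulKf// intr_eq0 gt_eqF.
  by rewrite fmorph_div rmorph_int rmorph_nat.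
exists (expR (ln (x i0) / N%:~R)), e; split.
- apply/andP; split; first exact: expR_gt0.
  by rewrite -[X in _ < X]expR0 ltr_expR pmulr_llt0 ?invr_gt0.
- move=> i; rewrite lt0n; apply/eqP => e0; have := he i; rewrite e0 => /eqP.
  by rewrite mulf_eq0 intr_eq0 !gt_eqF.
- move=> i; rewrite -expRM_natl; have /andP[xi0 _] := x01 i; rewrite -{1}[x i]lnK ?posrE//.
  have -> : ln (x i) = ratr (c i) * ln (x i0) by rewrite -hc divfK// lt_eqF.
  by rewrite cE; congr expR; ring.
Qed.

Lemma commensurable_of_log (R : realType) (A : set R) (z : R) :
  (forall x, A x -> exists c : rat, ln x = ratr c * z) -> commensurable A.
Proof.
move=> h x y /h[c ->] /h[c' ->]; have [->|z0] := eqVneq z 0.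
  by exists 0; rewrite !mulr0 mul0r rmorph0.
exists (c / c'); rewrite fmorph_div /= invfM mulrACA mulfV ?mulr1//.
Qed.

Lemma log_of_relation (R : realType) (x lam : R) k k' l l' : 0 < x -> 0 < lam ->
  (k < k')%N -> x ^+ k' * lam ^+ l = x ^+ k * lam ^+ l' ->
  exists c : rat, ln x = ratr c * ln lam.
Proof.
move=> x0 lam0 kk /(congr1 (@ln R)).
rewrite !lnM ?posrE ?exprn_gt0// !lnXn// => e.
exists ((l'%:R - l%:R) / (k'%:R - k%:R)).
have d0 : (k'%:R - k%:R : R) != 0 by rewrite subr_eq0 eqr_nat gtn_eqF.
rewrite fmorph_div !rmorphB /= !rmorph_nat mulrAC; apply/esym/(canLR (mulfK d0)).
move: e; rewrite -[ln x *+ k']mulr_natl -[ln x *+ k]mulr_natl.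
by rewrite -[ln lam *+ l]mulr_natl -[ln lam *+ l']mulr_natl => e; lra.
Qed.

(** * Transfer between sets and symbolic spaces *)

Lemma powR_le_inv (R : realType) (x y s : R) : 0 < s -> 0 <= x -> 0 <= y ->
  x `^ s <= y `^ s -> x <= y.
Proof.
move=> s0 x0 y0; rewrite !leNgt; apply: contra => lt.
by apply: gt0_ltr_powR.
Qed.

Section Transfer.
Variables (R : realType) (d e m n : nat) (X : set 'rV[R]_d) (Y : set 'rV[R]_e).
Variables (r : 'I_m -> R) (t : 'I_n -> R) (s : R).
Hypothesis s0 : 0 < s.
Hypothesis r01 : forall i, 0 < r i < 1.
Hypothesis t01 : forall j, 0 < t j < 1.
Variables (ptX : (nat -> 'I_m) -> 'rV[R]_d) (adX : 'rV[R]_d -> nat -> 'I_m) (DX delX : R).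
Variables (ptY : (nat -> 'I_n) -> 'rV[R]_e) (adY : 'rV[R]_e -> nat -> 'I_n) (DY delY : R).
Hypothesis codX : coding X r ptX adX DX delX.
Hypothesis codY : coding Y t ptY adY DY delY.
Local Notation p := (fun i => r i `^ s).
Local Notation q := (fun j => t j `^ s).

(** The power [s] turns Lipschitz conditions for the ratios into Lipschitz
    conditions for the weights. *)
Lemma symbolic_of_metric f : lipschitz_surjection X Y f ->
  exists F C, Lip p q C F /\ forall y, exists x, F x = y.
Proof.
move=> [[L hL] fXY].
have [[DX0 delX0] XP _ Xup _] := codX; have [[_ delY0] YP YK _ Ylow] := codY.
have Yf x : Y (f (ptX x)) by rewrite -fXY; exists (ptX x) => //; exact: (XP x).1.
pose K := `|L| * DX / delY.
have K0 : 0 <= K by rewrite !mulr_ge0// ?invr_ge0 ltW.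
exists (adY \o f \o ptX), (K `^ s); split.
  move=> k l x y xy lt; apply: contrapT => /first_disagreement[k' [kl ag ne]].
  have h1 := Ylow _ _ _ ag ne; rewrite /= !YK// in h1.
  have h2 := hL _ _ (XP x).1 (XP y).1.
  have h3 : L * edist (ptX x) (ptX y) <= `|L| * (DX * wt r x k).
    apply: (@le_trans _ _ (`|L| * edist (ptX x) (ptX y))).
      by apply: ler_wpM2r; [exact: eucl_ge0|exact: ler_norm].
    by rewrite ler_wpM2l// Xup.
  have h4 : wt t (adY (f (ptX x))) l <= K * wt r x k.
    apply: (@le_trans _ _ (wt t (adY (f (ptX x))) k')); first exact: wt_decr.
    rewrite /K mulrAC ler_pdivlMr// mulrC.
    by apply: le_trans h1 _; apply: le_trans h2 _; rewrite -mulrA.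
  move: lt; rewrite !wt_powR// -powRM// ?(ltW (wt_gt0 r01 _ _))//.
  rewrite ltNge => /negP; apply; apply: ge0_ler_powR => //; first exact: ltW.
    by rewrite nnegrE ltW// wt_gt0.
  by rewrite nnegrE mulr_ge0// ltW// wt_gt0.
move=> y; have : Y (ptY y) by case: (YP y).
rewrite -fXY => -[x Xx fx]; exists (adX x) => /=.
have [_ _ XK _ _] := codX.
by rewrite XK// fx (YP y).2.
Qed.

Lemma metric_of_symbolic F C : Lip p q C F -> (forall y, exists x, F x = y) ->
  exists f, lipschitz_surjection X Y f.
Proof.
move=> LF sF.
have [[_ delX0] XP XK _ Xlow] := codX; have [[DY0 _] YP YK Yup _] := codY.
pose C' := `|C| + 1; have C'0 : 0 < C' by apply: ltr_wpDl.
have p01 i : 0 < r i `^ s < 1 by apply: powR01.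
have LF' : Lip p q C' F.
  by apply: (LipW p01) LF; apply: le_trans (ler_norm C) _; rewrite lerDl.
pose K := C' `^ s^-1.
have K0 : 0 < K by rewrite powR_gt0.
have KE : K `^ s = C' by rewrite /K -powRrM mulVf ?gt_eqF// powRr1// ltW.
exists (ptY \o F \o adX); split.
  exists (DY * K / delX) => x y Xx Xy /=.
  have L0 : 0 <= DY * K / delX * edist x y.
    by apply: mulr_ge0; rewrite ?eucl_ge0// !mulr_ge0// ?invr_ge0 ltW.
  have [exy|/first_difference[k [agk nek]]] := pselect (adX x = adX y).
    by rewrite exy euclxx.
  have [exy|/first_difference[l [agl nel]]] := pselect (F (adX x) = F (adX y)).
    by rewrite exy euclxx.
  have h1 : wt t (F (adX x)) l <= K * wt r (adX x) k.
    apply: (powR_le_inv s0); first exact/ltW/wt_gt0.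
      by rewrite mulr_ge0// ltW// wt_gt0.
    rewrite powRM ?(ltW K0) ?(ltW (wt_gt0 r01 _ _))// KE -!wt_powR// leNgt.
    by apply/negP => lt; apply: nel; apply: (LF' _ _ _ _ agk lt).
  have h2 := Xlow _ _ _ agk nek; rewrite !XK// in h2.
  apply: le_trans (Yup _ _ _ agl) _.
  rewrite -!mulrA ler_pM2l//; apply: le_trans h1 _; rewrite ler_pM2l//.
  by rewrite mulrC ler_pdivlMr// mulrC.
apply/seteqP; split => [_ [x Xx <-]|y Yy]; first by case: (YP (F (adX x))).
have [x hx] := sF (adY y); exists (ptX x); first by case: (XP x).
by rewrite /= (XP x).2 hx YK.
Qed.

End Transfer.

(** By Moran's equation there are at least two symbols, hence two distinct
    points, and a similarity has only one ratio. *)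
Lemma dust_like_coding (R : realType) (d m : nat)
    (Phi : 'I_m -> 'rV[R]_d -> 'rV[R]_d) (X : set 'rV[R]_d) (s : R) :
  dust_like Phi X -> 0 < s -> hausdorff_dim X = s%:E ->
  exists (r : 'I_m -> R) pt ad D del,
    [/\ forall i, 0 < r i < 1, \sum_i r i `^ s = 1, coding X r pt ad D del,
        forall i, ratios Phi (r i) & forall x, ratios Phi x -> exists i, x = r i].
Proof.
move=> dust s0 dimX.
have X0 : X !=set0.
  apply/set0P; apply/eqP => X0; move: dimX; rewrite X0 hausdorff_dim_set0 => -[].
  by move=> e; rewrite -e ltxx in s0.
have /choice[r simr] : forall i, exists x, contracting_similarity x (Phi i).
  by case: dust => -[].
have r01 i : 0 < r i < 1 by case: (simr i).
have [pt [ad [D [del cod]]]] := coding_ex dust simr X0.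
have [i0 _] : exists i : 'I_m, True.
  by have [x Xx] := X0; exists (ad x 0%N).
have sr := moran_equation r01 i0 cod s0 dimX.
exists r, pt, ad, D, del; split => //; first by move=> i; exists i.
move=> x [i [x01 simx]]; exists i.
have [i1 i1P] : exists i1, i1 <> i0.
  apply: contrapT => hn; have : \sum_j r j `^ s = r i0 `^ s.
    rewrite (bigD1 i0)//= big1 ?addr0// => j /eqP ji; case: hn; exists j => //.
  by rewrite sr => e; have := powR01 (r01 i0) s0; rewrite -e ltxx andbF.
have [[_ del0] _ _ _ low] := cod.
have := low 0%N (fun=> i1) (fun=> i0) (fun k => ltac:(by [])) i1P.
rewrite wt0 mulr1; set a := pt _; set b := pt _ => ab.
have ab0 : 0 < edist a b by apply: lt_le_trans ab.
have [_ hr] := simr i; apply: (mulIf (lt0r_neq0 ab0)).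
by rewrite -simx -hr.
Qed.

Theorem theorem1p4 (R : realType) (d e m n : nat)
    (Phi : 'I_m -> 'rV[R]_d -> 'rV[R]_d)
    (Psi : 'I_n -> 'rV[R]_e -> 'rV[R]_e)
    (X : set 'rV[R]_d) (Y : set 'rV[R]_e) (s : R)
    (dustX : dust_like Phi X) (dustY : dust_like Psi Y)
    (s_gt0 : 0 < s)
    (dimX : hausdorff_dim X = s%:E) (dimY : hausdorff_dim Y = s%:E)
    (comm : commensurable (ratios Phi) \/ commensurable (ratios Psi)) :
  (exists f : 'rV[R]_d -> 'rV[R]_e, lipschitz_surjection X Y f) <->
  commensurable (ratios Phi `|` ratios Psi).
Proof.
have [r [ptX [adX [DX [delX [r01 sr codX rP Pr]]]]]] := dust_like_coding dustX s_gt0 dimX.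
have [t [ptY [adY [DY [delY [t01 st codY tP Pt]]]]]] := dust_like_coding dustY s_gt0 dimY.
pose p i := r i `^ s; pose q j := t j `^ s.
have p01 i : 0 < p i < 1 by apply: powR01.
have q01 j : 0 < q j < 1 by apply: powR01.
have ln_ratio x y : ln (x `^ s) / ln (y `^ s) = ln x / ln y :> R.
  by rewrite !ln_powR -mulf_div divff ?mul1r// gt_eqF.
split.
- move=> [f fXY].
  have [F [C [LF sF]]] := symbolic_of_metric s_gt0 r01 t01 codX codY fXY.
  have [relX relY] := lipschitz_surjection_relations p01 q01 sr st LF sF.
  suff [lam [hp hq]] : exists lam : R,
      (forall i, exists c : rat, ln (p i) = ratr c * ln lam) /\
      (forall j, exists c : rat, ln (q j) = ratr c * ln lam).
    apply: (commensurable_of_log (z := ln lam / s)) => x [/Pr[i ->]|/Pt[j ->]].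
      have [c hc] := hp i; exists c.
      by rewrite mulrA -hc ln_powR mulrAC divff ?mul1r// gt_eqF.
    have [c hc] := hq j; exists c.
    by rewrite mulrA -hc ln_powR mulrAC divff ?mul1r// gt_eqF.
  have ln_pow lam k : 0 < lam -> exists c : rat, ln (lam ^+ k) = ratr c * ln lam :> R.
    by move=> l0; exists k%:R; rewrite lnXn// rmorph_nat mulr_natl.
  case: comm => [comX|comY].
    have [|lam [a [lam01 _ pa]]] := common_base p01.
      by move=> i j; rewrite ln_ratio; apply: comX.
    have [lam0 _] := andP lam01; exists lam; split=> [i|j]; first by rewrite pa; apply: ln_pow.
    have [k [k' [l [l' [kk rel]]]]] := relY lam a j lam01 pa.
    by apply: log_of_relation kk rel => //; case/andP: (q01 j).
  have [|lam [b [lam01 _ qb]]] := common_base q01.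
    by move=> i j; rewrite ln_ratio; apply: comY.
  have [lam0 _] := andP lam01; exists lam; split=> [i|j]; last by rewrite qb; apply: ln_pow.
  have wq w : exists l, wordwt q w = lam ^+ l.
    elim: w => [|j w [l hl]]; first by exists 0%N; rewrite /wordwt big_nil expr0.
    by exists (b j + l)%N; rewrite /wordwt big_cons -/(wordwt q w) hl qb exprD.
  have [k [k' [w [w' [kk rel]]]]] := relX i.
  have [l hl] := wq w; have [l' hl'] := wq w'.
  rewrite -/q hl hl' in rel.
  by apply: log_of_relation kk rel => //; case/andP: (p01 i).
- move=> com.
  pose x (i : 'I_m + 'I_n) := match i with inl i => p i | inr j => q j end.
  have [||lam [c [lam01 c0 xc]]] := @common_base R _ x.
  + by case.
  + move=> i j; have [y [Ay ->]] : exists y, (ratios Phi `|` ratios Psi) y /\ x i = y `^ s.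
      by case: i => i; [exists (r i)|exists (t i)]; split => //; [left|right].
    have [z [Az ->]] : exists z, (ratios Phi `|` ratios Psi) z /\ x j = z `^ s.
      by case: j => j; [exists (r j)|exists (t j)]; split => //; [left|right].
    by rewrite ln_ratio; apply: com.
  pose a i := c (inl i); pose b j := c (inr j).
  have ep : p = fun i => lam ^+ a i by apply/funext => i; exact: (xc (inl i)).
  have eq : q = fun j => lam ^+ b j by apply/funext => j; exact: (xc (inr j)).
  have sa : \sum_i lam ^+ a i = 1 by rewrite -sr; apply: eq_bigr => i _; rewrite -(xc (inl i)).
  have sb : \sum_j lam ^+ b j = 1 by rewrite -st; apply: eq_bigr => j _; rewrite -(xc (inr j)).
  have [F [C [LF sF]]] := lipschitz_surjection_ex (fun i => c0 (inl i)) (fun j => c0 (inr j))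
    lam01 sa sb.
  apply: (metric_of_symbolic s_gt0 r01 t01 codX codY (F := F) (C := C)) => //.
  by rewrite -/p -/q ep eq.
Qed.
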